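(* Let $\{\mathscr{O}_i(x_i^0,\pi/3)\}_{i=0}^\infty$ be a compatible sequence of periodic orbits and let $\mathscr{L}$ be the length of the Fagnano orbit of the equilateral triangle billiard $\Omega(KS_0)$ (i.e. the shortest inscribed polygon in $\Omega(KS_0)$). Then, for each $n\ge 0$, the length $|\mathscr{O}_n(x_n^0,\pi/3)|$ of the path traced out by connecting consecutive basepoints of the orbit $\mathscr{O}_n(x_n^0,\pi/3)$ is given by $$|\mathscr{O}_n(x_n^0,\pi/3)| = 2\mathscr{L}+\sum_{i=2}^n \chi[(x_0^0)_i]\,\#\mathscr{O}_{i-1}(x_{i-1}^0,\pi/3)\,\frac{\mathscr{L}}{3^i},$$ where $(x_0^0)_i$ denotes the $i$th character in the ternary expansion representing $x_0^0$.
   Context: Let $KS_0=\Delta$ be the equilateral triangle of side length $1$ with base $I=[0,1]$. For $n\ge 0$, $KS_{n+1}$ is obtained from the polygon $KS_n$ by removing the open middle third of each of its $3\cdot 4^n$ sides and replacing it by the two other sides of the equilateral triangle erected on it, pointing outward. $\Omega(KS_n)$ is the compact region bounded by $KS_n$. The billiard map $f_n$ on $(KS_n\times S^1)/\sim$ sends a boundary point with inward pointing direction $(x,\theta)$ to $(x^1,\theta^1)$, where $x^1$ is the first point of $KS_n$ hit by the ray from $x$ in direction $\theta$ and $\theta^1$ is the inward direction obtained by reflecting $\theta$ in the side containing $x^1$. The orbit $\mathscr{O}_n(x_n^0,\theta_n^0)$ is the collection of points $(x_n^k,\theta_n^k)=f_n^k(x_n^0,\theta_n^0)$; the $x_n^k$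 are its basepoints. An orbit is singular if it hits a vertex of $KS_n$; it is periodic if it is closed and non-singular. Its period $\#\mathscr{O}_n$ is its number of elements. All angles are measured in a fixed coordinate system placed at the base of $KS_0$. The Fagnano orbit of $\Omega(KS_0)$ is the orbit starting at the midpoint of the base of $\Delta$ in the direction $\pi/3$. A sequence of orbits $\{\mathscr{O}_i(x_i^0,\theta_i^0)\}_{i\ge0}$, $\mathscr{O}_i$ an orbit of $\Omega(KS_i)$, is compatible if for every $n$: $\theta_n^0=\theta_0^0$, $x_n^0\in KS_n$ is collinear with $x_0^0$ in the direction $\theta_0^0$, and there are no points of $KS_n$ between $x_n^0$ and $x_0^0$. It is a compatible sequence of periodic orbits if all its orbits are periodic. Here $\theta_i^0=\pi/3$ and $x_0^0\in I$. Points $x_0^0$ with a finite ternary expansion lead to singular orbits and are not considered. Ternary expansions use the digits $0,1,2$, and $\chi$ is the characteristic function of $\{1\}$ on $\{0,1,2\}$: $\chi[0]=\chi[2]=0$, $\chi[1]=1$.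
   Formalization: The case n = 0 with x_0^0 = 1/2 is excluded: there the orbit is the Fagnano orbit itself, of length L, while the formula would give 2L; the case x_0^0 = 1/2 with n ≥ 1 is still covered. *)

(* Defs.v *)
(* Stdlib reals with Coquelicot.  The plane is identified with Coquelicot's
   complex numbers C, and the circle of directions with the unit complex
   numbers, the angle theta being exp(i theta). *)
From Stdlib Require Import Ensembles Finite_sets ClassicalEpsilon Reals Arith List.
From Coquelicot Require Import Coquelicot.

Open Scope R_scope.

Definition unit_dir (theta : R) : C := (cos theta, sin theta).

Definition ray (x v : C) (t : R) : C := Cplus x (Cmult (RtoC t) v).

(* A side is an ordered pair of endpoints.  Every KS_n is listed
   counterclockwise, so the region it bounds is on the left of each side. *)
Definition side : Type := (C * C)%type.

Definition on_side (e : side) (z : C) : Prop :=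
  exists t : R, 0 <= t <= 1 /\ z = ray (fst e) (Cminus (snd e) (fst e)) t.

(* The new triangle lies on the right of the oriented side, i.e. outside:
   its apex is reached from p by turning a third of the side by -PI/3. *)
Definition koch_split (e : side) : list side :=
  let a := fst e in
  let b := snd e in
  let h := Cdiv (Cminus b a) (RtoC 3) in
  let p := Cplus a h in
  let r := Cplus p h in
  let q := Cplus p (Cmult (unit_dir (- (PI / 3))) h) in
  (a, p) :: (p, q) :: (q, r) :: (r, b) :: nil.

Fixpoint KS_sides (n : nat) : list side :=
  match n with
  | O => (RtoC 0, RtoC 1) :: (RtoC 1, unit_dir (PI / 3))
           :: (unit_dir (PI / 3), RtoC 0) :: nil
  | S m => flat_map koch_split (KS_sides m)
  end.

Definition KS (n : nat) (z : C) : Prop :=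
  exists e, In e (KS_sides n) /\ on_side e z.

Definition KS_vertex (n : nat) (z : C) : Prop :=
  exists e, In e (KS_sides n) /\ (z = fst e \/ z = snd e).

(* Strictly to the left of the oriented side: Im (conj u * v) is the
   determinant of (u, v). *)
Definition inward (e : side) (v : C) : Prop :=
  0 < Im (Cmult (Cconj (Cminus (snd e) (fst e))) v).

Definition reflect_dir (e : side) (v : C) : C :=
  let u := Cminus (snd e) (fst e) in
  Cmult (Cdiv u (Cconj u)) (Cconj v).

(* A pair (basepoint, direction).  Each class of (KS_n x S^1)/~ is represented
   by its inward pointing direction. *)
Definition state : Type := (C * C)%type.

Definition phase_point (n : nat) (s : state) : Prop :=
  Cmod (snd s) = 1 /\
  exists e, In e (KS_sides n) /\ on_side e (fst s) /\ inward e (snd s).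

Definition billiard_step (n : nat) (s s' : state) : Prop :=
  (exists t : R, 0 < t /\ fst s' = ray (fst s) (snd s) t /\ KS n (fst s') /\
     forall r : R, 0 < r < t -> ~ KS n (ray (fst s) (snd s) r)) /\
  (exists e, In e (KS_sides n) /\ on_side e (fst s') /\
     snd s' = reflect_dir e (snd s)).

(* From an inward non-vertex state the next state exists, and it is unique
   unless its basepoint is a vertex.  The arbitrary choice made there is
   immaterial: such an orbit is singular whatever follows. *)
Definition billiard_map (n : nat) (s : state) : state :=
  epsilon (inhabits s) (billiard_step n s).

Definition orbit_pt (n : nat) (s : state) (k : nat) : state :=
  Nat.iter k (billiard_map n) s.

Definition orbit (n : nat) (s : state) : Ensemble state :=
  fun q => exists k : nat, q = orbit_pt n s k.

Definition singular (n : nat) (s : state) : Prop :=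
  exists q, orbit n s q /\ KS_vertex n (fst q).

Definition closed_orbit (n : nat) (s : state) : Prop :=
  exists k : nat, (0 < k)%nat /\ orbit_pt n s k = s.

Definition periodic (n : nat) (s : state) : Prop :=
  phase_point n s /\ closed_orbit n s /\ ~ singular n s.

(* The number of elements of the orbit; meaningful when the orbit is finite. *)
Definition period (n : nat) (s : state) : nat :=
  epsilon (inhabits 0%nat) (cardinal state (orbit n s)).

(* One full turn of a closed orbit: the last segment returns to the start. *)
Definition orbit_length (n : nat) (s : state) : R :=
  sum_n_m (fun k => Cmod (Cminus (fst (orbit_pt n s k))
                                 (fst (orbit_pt n s (k - 1)))))
          1 (period n s).

Definition fagnano : state := (RtoC (1 / 2), unit_dir (PI / 3)).

Definition compatible (s : nat -> state) : Prop :=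
  forall n : nat,
    phase_point n (s n) /\
    snd (s n) = snd (s 0%nat) /\
    exists t : R,
      fst (s n) = ray (fst (s 0%nat)) (snd (s 0%nat)) t /\
      forall r : R, Rmin 0 t < r < Rmax 0 t ->
        ~ KS n (ray (fst (s 0%nat)) (snd (s 0%nat)) r).

Definition compatible_periodic (s : nat -> state) : Prop :=
  compatible s /\ forall n : nat, periodic n (s n).

(* Digits are indexed from 1; the value d 0 is not used. *)
Definition ternary_expansion (d : nat -> nat) (a : R) : Prop :=
  (forall i : nat, (1 <= i)%nat -> (d i <= 2)%nat) /\
  is_series (fun k : nat => INR (d (S k)) / 3 ^ (S k)) a.

Definition finite_ternary (a : R) : Prop :=
  exists (d : nat -> nat) (N : nat),
    ternary_expansion d a /\ forall i : nat, (N <= i)%nat -> d i = 0%nat.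

Definition chi (d : nat) : R := if Nat.eqb d 1 then 1 else 0.

(* Main.v *)
Require Import Defs.
From Stdlib Require Import Ensembles Finite_sets Finite_sets_facts.
From Stdlib Require Import ClassicalEpsilon FunctionalExtensionality.
From Stdlib Require Import Reals Arith List Lra Lia.
From Coquelicot Require Import Coquelicot.

Open Scope R_scope.

(** Every side of [KS n] points in a direction that is a multiple of PI/3; call
    the side even or odd accordingly.  A trajectory that starts in the direction
    PI/3 only ever uses the directions PI/3, PI and -PI/3, and such a trajectory
    leaves a side along a direction that the side and its parity determine.
    Moreover all trajectories leaving one side [e] hit one and the same side
    [e'], and the one leaving at relative position [s] arrives at [1 - s]:
    between them they sweep a strip that contains no vertex.  [link n e e' lam]
    records this fact together with the length of the leg, an affine function of
    [s] with slope [3^-n * (o + o' - 1)] for the parities [o], [o'] (1 when odd)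
    and with the value [lam] at the midpoint.

    Links are inherited by refinement.  If [s] is not in the middle third, the
    same leg joins an extreme child of [e] to an extreme child of [e'].  If it
    is, the trajectory passes through the gap, bounces twice in the small
    triangle erected there, and leaves with its old outgoing direction at the
    mirrored position.  So a cyclic itinerary of sides stays cyclic with the same
    length when the ternary digit is 0 or 2 and doubles in length when the digit
    is 1; the relative position evolves by [s -> 3 s - digit].  The exception is
    the first refinement, where the Fagnano cycle of three sides doubles for all
    digits: positions alternate between [s] and [1 - s], and three is odd.

    As to lengths, along a cycle of even length the terms of the legs that depend
    on [s] telescope, since the parities occur as [o_i + o_(i+1)] with alternating
    signs.  Only the midpoint lengths remain ([total_leg]).  The digits 0 and 2
    leave the path itself unchanged, and the digit 1 adds half of [3^-n] per bounce
    ([total_middle]), which is the Fagnano length 3/2 divided by [3^(n+1)].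

    That trajectories do not hit [KS n] prematurely rests on the closed triangles
    of side length [3^-n] on the outer side of each side: those of the children
    lie in that of the parent, and those of different sides overlap at most along
    their boundaries ([outer_triangles_separated]).  Legs avoid all of them, and
    so, by nesting, all later curves outside the gaps.
    Finally the starting point of a compatible sequence is identified in
    [start_unique]: it is the only point of [KS n] other than a vertex that is
    visible from [x_0] along the line and at which PI/3 points inward. *)

(** * Sides and the triangles outside them *)

(** A side multiplied by this sixth root of unity points out of the
    counterclockwise curve.  It satisfies [w * w = w - 1], and [1 - w] is its
    conjugate. *)
Definition w : C := unit_dir (- (PI / 3)).

Lemma w_pair : w = (1/2, - (sqrt 3 / 2)).
Proof.
  unfold w, unit_dir.
  now rewrite cos_neg, sin_neg, cos_PI3, sin_PI3.
Qed.

Lemma omega_pair : unit_dir (PI / 3) = (1/2, sqrt 3 / 2).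
Proof. unfold unit_dir. now rewrite cos_PI3, sin_PI3. Qed.

(** Oblique coordinates attached to a side, in which the side is the segment
    from (0,0) to (1,0), positive second coordinates lie on its right, and the
    equilateral triangle erected outward on it has third vertex (0,1). *)
Definition pt (e : side) (x y : R) : C :=
  Cplus (fst e) (Cmult (Cminus (snd e) (fst e))
                       (Cplus (RtoC x) (Cmult (RtoC y) w))).

(* Identities between complex numbers are polynomial in the coordinates once
   the square root of 3 is a variable k with k * k = 3. *)
Ltac ceq :=
  unfold Cdiv, Cinv, Cminus, Cconj; rewrite ?omega_pair, ?w_pair;
  apply injective_projections; simpl;
  let H := fresh in
  let k := fresh in
  pose proof (sqrt_sqrt 3 ltac:(lra)) as H;
  generalize dependent (sqrt 3); intros k H; field [H].

Definition child (i : nat) (e : side) : side := nth i (koch_split e) e.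

Definition child_x (i : nat) (x y : R) : R :=
  match i with
  | 0%nat => x / 3
  | 1%nat => 1/3 - y / 3
  | 2%nat => 1/3 + (x + y) / 3
  | _ => 2/3 + x / 3
  end.

Definition child_y (i : nat) (x y : R) : R :=
  match i with
  | 0%nat => y / 3
  | 1%nat => (x + y) / 3
  | 2%nat => 1/3 - x / 3
  | _ => y / 3
  end.

(** Each child sees its parent's coordinates through an affine map with rational
    coefficients, so inclusions between triangles of successive curves become
    linear arithmetic. *)
Lemma pt_child i e x y : (i < 4)%nat ->
  pt (child i e) x y = pt e (child_x i x y) (child_y i x y).
Proof.
  intros Hi; destruct e as [[a1 a2] [b1 b2]].
  destruct i as [|[|[|[|]]]]; [| | | | lia];
    unfold child, koch_split; cbn [nth]; fold w; unfold pt;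
    cbn [fst snd child_x child_y]; ceq.
Qed.

Definition vec (e : side) : C := Cminus (snd e) (fst e).

Definition child_turn (i : nat) : C :=
  match i with
  | 1%nat => w
  | 2%nat => Cminus (RtoC 1) w
  | _ => RtoC 1
  end.

Lemma vec_child i e : (i < 4)%nat ->
  vec (child i e) = Cmult (RtoC (/ 3)) (Cmult (child_turn i) (vec e)).
Proof.
  intros Hi; destruct e as [[a1 a2] [b1 b2]].
  destruct i as [|[|[|[|]]]]; [| | | | lia];
    unfold child, koch_split; cbn [nth]; fold w; unfold vec, child_turn;
    cbn [fst snd]; ceq.
Qed.

Lemma in_KS_S n f :
  In f (KS_sides (S n)) <->
  exists e i, In e (KS_sides n) /\ (i < 4)%nat /\ f = child i e.
Proof.
  cbn [KS_sides]. rewrite in_flat_map. split.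
  - intros [e [He Hf]]. exists e.
    unfold child.
    destruct Hf as [H|[H|[H|[H|[]]]]];
      [exists 0%nat|exists 1%nat|exists 2%nat|exists 3%nat];
      (split; [exact He|split; [lia|symmetry; exact H]]).
  - intros [e [i [He [Hi Hf]]]]. exists e. split; [exact He|].
    subst f. unfold child. apply nth_In. exact Hi.
Qed.

Definition outer_closed (e : side) (z : C) : Prop :=
  exists x y, 0 <= x /\ 0 <= y /\ x + y <= 1 /\ z = pt e x y.

(** The interior of the outer triangle together with the open side that it is
    erected on: a trajectory enters a gap through that side. *)
Definition outer_open (e : side) (z : C) : Prop :=
  exists x y, 0 < x /\ 0 <= y /\ x + y < 1 /\ z = pt e x y.

(** The new small triangle with its open base, that is, the part that the next
    curve adds to the region at this side. *)
Definition gap_open (e : side) (z : C) : Prop :=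
  exists x y, 1/3 < x /\ 0 <= y /\ x + y < 2/3 /\ z = pt e x y.

Lemma pt_diff e x y x' y' :
  Cminus (pt e x y) (pt e x' y') =
  Cmult (vec e) (Cplus (RtoC (x - x')) (Cmult (RtoC (y - y')) w)).
Proof.
  destruct e as [[a1 a2] [b1 b2]]. unfold pt, vec. cbn [fst snd]. ceq.
Qed.

Lemma pt_inj e x y x' y' :
  vec e <> RtoC 0 -> pt e x y = pt e x' y' -> x = x' /\ y = y'.
Proof.
  intros Hv H.
  assert (H0 : Cmult (vec e) (Cplus (RtoC (x - x')) (Cmult (RtoC (y - y')) w))
               = RtoC 0).
  { rewrite <- pt_diff, H. unfold Cminus. apply Cplus_opp_r. }
  destruct (Ceq_dec (Cplus (RtoC (x - x')) (Cmult (RtoC (y - y')) w)) (RtoC 0))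
    as [E|E].
  - rewrite w_pair in E. unfold Cplus, Cmult, RtoC in E. simpl in E.
    injection E as E1 E2.
    pose proof (sqrt_lt_R0 3 ltac:(lra)).
    assert (y - y' = 0) by nra. nra.
  - exfalso. exact (Cmult_neq_0 _ _ Hv E H0).
Qed.

(** * Directions *)

(** The boolean is the parity of the side, [true] when its direction is an odd
    multiple of PI/3.  It is carried along because it decides the direction in
    which trajectories leave. *)
Definition tside : Type := (side * bool)%type.

Definition parity (o : bool) : R := if o then 1 else 0.

(** Exactly one of the directions PI/3, PI and -PI/3 points inward at a given
    side: it is turned from the side by PI/3 when the side is even and by 2 PI/3
    when it is odd.  The factor [3^n] normalizes the length of the side. *)
Definition out_dir (n : nat) (p : tside) : C :=
  Cmult (RtoC (3 ^ n))
        (Cmult (vec (fst p)) (Cminus (RtoC (1 - parity (snd p))) w)).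

(** The direction whose reflection in the side is [out_dir]. *)
Definition in_dir (n : nat) (p : tside) : C :=
  Cmult (RtoC (3 ^ n))
        (Cmult (vec (fst p)) (Cminus w (RtoC (parity (snd p))))).

Definition omega : C := unit_dir (PI / 3).

Definition tri_dir (v : C) : Prop := v = omega \/ v = RtoC (-1) \/ v = w.

Definition kid (i : nat) (p : tside) : tside :=
  (child i (fst p), match i with 1%nat | 2%nat => negb (snd p) | _ => snd p end).

(** Of the two children erected on the gap, the one that an arriving trajectory
    reaches first, and the one from which it leaves through the gap.  The arriving
    direction is parallel to one of the two, and which one depends on the
    parity. *)
Definition in_kid (p : tside) : tside := kid (if snd p then 1 else 2) p.
Definition out_kid (p : tside) : tside := kid (if snd p then 2 else 1) p.

Definition side_pt (p : tside) (s : R) : C := pt (fst p) s 0.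

Ltac dir_tac p :=
  destruct p as [e []];
  unfold in_kid, out_kid, kid, out_dir, in_dir; cbn [fst snd negb parity];
  rewrite ?vec_child by lia; cbn [child_turn pow];
  destruct (vec e) as [v1 v2]; ceq.

Lemma out_dir_kid0 n p : out_dir (S n) (kid 0 p) = out_dir n p.
Proof. dir_tac p. Qed.
Lemma out_dir_kid3 n p : out_dir (S n) (kid 3 p) = out_dir n p.
Proof. dir_tac p. Qed.
Lemma in_dir_kid0 n p : in_dir (S n) (kid 0 p) = in_dir n p.
Proof. dir_tac p. Qed.
Lemma in_dir_kid3 n p : in_dir (S n) (kid 3 p) = in_dir n p.
Proof. dir_tac p. Qed.
Lemma out_dir_out_kid n p : out_dir (S n) (out_kid p) = out_dir n p.
Proof. dir_tac p. Qed.
Lemma in_dir_in_kid n p : in_dir (S n) (in_kid p) = in_dir n p.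
Proof. dir_tac p. Qed.
(** Between its two bounces in the small triangle a trajectory runs parallel to
    the gap, forward or backward according to the parity. *)
Lemma out_dir_in_kid n p :
  out_dir (S n) (in_kid p) =
  Cmult (RtoC (3 ^ n * (2 * parity (snd p) - 1))) (vec (fst p)).
Proof. dir_tac p. Qed.
Lemma in_dir_out_kid n p :
  in_dir (S n) (out_kid p) = out_dir (S n) (in_kid p).
Proof. dir_tac p. Qed.

Definition tagged (n : nat) (p : tside) : Prop :=
  In (fst p) (KS_sides n) /\ tri_dir (out_dir n p).

Lemma out_dir_in_kid_turn n p :
  out_dir (S n) (in_kid p) =
  Cmult (RtoC (-1))
        (Cmult (out_dir n p) (if snd p then Cminus (RtoC 1) w else w)).
Proof.
  rewrite out_dir_in_kid. dir_tac p.
Qed.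

Lemma tri_dir_in_kid n p : tri_dir (out_dir n p) -> tri_dir (out_dir (S n) (in_kid p)).
Proof.
  rewrite out_dir_in_kid_turn. unfold tri_dir, omega.
  intros [H|[H|H]]; rewrite H; clear H; destruct (snd p);
    first [ left; solve [ceq] | right; left; solve [ceq] | right; right; solve [ceq] ].
Qed.

Lemma tagged_kid0 n p : tagged n p -> tagged (S n) (kid 0 p).
Proof.
  intros [H1 H2]; split; [|rewrite out_dir_kid0; exact H2].
  apply in_KS_S. exists (fst p), 0%nat. auto with arith.
Qed.

Lemma tagged_kid3 n p : tagged n p -> tagged (S n) (kid 3 p).
Proof.
  intros [H1 H2]; split; [|rewrite out_dir_kid3; exact H2].
  apply in_KS_S. exists (fst p), 3%nat. auto with arith.
Qed.

Lemma tagged_in_kid n p : tagged n p -> tagged (S n) (in_kid p).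
Proof.
  intros [H1 H2]; split; [|apply tri_dir_in_kid; exact H2].
  apply in_KS_S. exists (fst p). exists (if snd p then 1%nat else 2%nat).
  destruct (snd p) eqn:E; unfold in_kid; rewrite E; auto with arith.
Qed.

Lemma tagged_out_kid n p : tagged n p -> tagged (S n) (out_kid p).
Proof.
  intros [H1 H2]; split; [|rewrite out_dir_out_kid; exact H2].
  apply in_KS_S. exists (fst p). exists (if snd p then 2%nat else 1%nat).
  destruct (snd p) eqn:E; unfold out_kid; rewrite E; auto with arith.
Qed.

Lemma child_cases n f : In f (KS_sides (S n)) ->
  exists e, In e (KS_sides n) /\
    forall o, f = fst (kid 0 (e, o)) \/ f = fst (kid 3 (e, o)) \/
              f = fst (in_kid (e, o)) \/ f = fst (out_kid (e, o)).
Proof.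
  intros Hf. apply in_KS_S in Hf. destruct Hf as [e [i [He [Hi ->]]]].
  exists e. split; [exact He|]. intros [];
  destruct i as [|[|[|[|]]]]; try lia; unfold in_kid, out_kid, kid;
    cbn [fst snd]; tauto.
Qed.

Definition base_side (i : nat) : tside :=
  (match i with
   | 0%nat => (RtoC 0, RtoC 1)
   | 1%nat => (RtoC 1, unit_dir (PI / 3))
   | _ => (unit_dir (PI / 3), RtoC 0)
   end, false).

Lemma base_side_tagged i : tagged 0 (base_side i).
Proof.
  split.
  - destruct i as [|[|]]; simpl; tauto.
  - unfold tri_dir, out_dir, base_side, omega, vec.
    destruct i as [|[|]]; cbn [fst snd parity pow];
      first [ left; solve [ceq] | right; left; solve [ceq] | right; right; solve [ceq] ].
Qed.

Lemma exists_tag n e : In e (KS_sides n) -> exists o, tagged n (e, o).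
Proof.
  revert e; induction n as [|n IH]; intros e He.
  - exists false. destruct He as [<-|[<-|[<-|[]]]];
    [exact (base_side_tagged 0)|exact (base_side_tagged 1)|exact (base_side_tagged 2)].
  - destruct (child_cases _ _ He) as [e' [He' Hc]].
    destruct (IH _ He') as [o Ho].
    destruct (Hc o) as [H|[H|[H|H]]]; rewrite H.
    + eexists. rewrite <- surjective_pairing at 1. apply tagged_kid0, Ho.
    + eexists. rewrite <- surjective_pairing at 1. apply tagged_kid3, Ho.
    + eexists. rewrite <- surjective_pairing at 1. apply tagged_in_kid, Ho.
    + eexists. rewrite <- surjective_pairing at 1. apply tagged_out_kid, Ho.
Qed.

Lemma Cmod_out_dir n p : tagged n p -> Cmod (out_dir n p) = 1.
Proof.
  intros [_ H].
  assert (K : (1 / 2) ^ 2 + (sqrt 3 / 2) ^ 2 = 1).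
  { pose proof (sqrt_sqrt 3 ltac:(lra)). simpl. nra. }
  destruct H as [-> | [-> | ->]]; unfold omega; rewrite ?omega_pair, ?w_pair; unfold Cmod;
    cbn [fst snd RtoC].
  - rewrite K. apply sqrt_1.
  - replace ((-1) ^ 2 + 0 ^ 2) with 1 by ring. apply sqrt_1.
  - replace (- (sqrt 3 / 2)) with (-1 * (sqrt 3 / 2)) by ring.
    rewrite Rpow_mult_distr. replace ((-1) ^ 2) with 1 by ring.
    rewrite Rmult_1_l, K. apply sqrt_1.
Qed.

(** Outgoing directions are unit vectors, so no side is degenerate and oblique
    coordinates are unique. *)
Lemma vec_neq0 n e : In e (KS_sides n) -> vec e <> RtoC 0.
Proof.
  intros He H0. destruct (exists_tag _ _ He) as [o Ho].
  pose proof (Cmod_out_dir _ _ Ho) as H1. unfold out_dir in H1. cbn [fst] in H1.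
  rewrite H0, Cmult_0_l, Cmult_0_r, Cmod_0 in H1. lra.
Qed.

(** * Separation *)

Lemma outer_closed_child i e z : (i < 4)%nat ->
  outer_closed (child i e) z -> outer_closed e z.
Proof.
  intros Hi [x [y [Hx [Hy [Hxy ->]]]]]. rewrite pt_child by exact Hi.
  exists (child_x i x y), (child_y i x y).
  destruct i as [|[|[|[|]]]]; try lia; cbn [child_x child_y];
    (repeat split; lra).
Qed.

Lemma outer_open_child i e z : (i < 4)%nat ->
  outer_open (child i e) z -> outer_open e z.
Proof.
  intros Hi [x [y [Hx [Hy [Hxy ->]]]]]. rewrite pt_child by exact Hi.
  exists (child_x i x y), (child_y i x y).
  destruct i as [|[|[|[|]]]]; try lia; cbn [child_x child_y];
    (repeat split; lra).
Qed.

(** In the basis 1, [omega] all three sides of the initial triangle have integer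
    coordinates, so they can be compared by linear arithmetic. *)
Lemma base_coords i x y :
  pt (fst (base_side i)) x y =
  match i with
  | 0%nat => Cplus (RtoC (x + y)) (Cmult (RtoC (- y)) omega)
  | 1%nat => Cplus (RtoC (1 - x)) (Cmult (RtoC (x + y)) omega)
  | _ => Cplus (RtoC (- y)) (Cmult (RtoC (1 - x)) omega)
  end.
Proof.
  unfold pt, base_side, omega.
  destruct i as [|[|]]; cbn [fst snd]; ceq.
Qed.

Lemma omega_coords_inj u v u' v' :
  Cplus (RtoC u) (Cmult (RtoC v) omega) = Cplus (RtoC u') (Cmult (RtoC v') omega)
  -> u = u' /\ v = v'.
Proof.
  unfold omega. rewrite omega_pair. unfold Cplus, Cmult, RtoC. simpl.
  intros E. injection E as E1 E2.
  pose proof (sqrt_lt_R0 3 ltac:(lra)).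
  assert (v = v') by nra. subst. split; lra.
Qed.

Lemma base_outer_triangles_separated i j z :
  outer_open (fst (base_side i)) z -> outer_closed (fst (base_side j)) z ->
  fst (base_side i) = fst (base_side j).
Proof.
  intros [x [y [Hx [Hy [Hxy Hz]]]]] [x' [y' [Hx' [Hy' [Hxy' Hz']]]]].
  rewrite Hz in Hz'. rewrite !base_coords in Hz'.
  destruct i as [|[|]], j as [|[|]]; try reflexivity;
    apply omega_coords_inj in Hz'; exfalso; lra.
Qed.

(** The outer triangles of the children lie in the outer triangle of the parent,
    so different parents are handled by induction, and the four triangles inside
    a common parent are compared in the coordinates of the parent. *)
Lemma outer_triangles_separated n e e' z :
  In e (KS_sides n) -> In e' (KS_sides n) ->
  outer_open e z -> outer_closed e' z -> e = e'.
Proof.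
  revert e e'; induction n as [|n IH]; intros e e' He He' Ho Hc.
  - destruct He as [<-|[<-|[<-|[]]]]; destruct He' as [<-|[<-|[<-|[]]]];
      match goal with |- ?a = ?b =>
        let f s := match s with
          | (RtoC 0, _) => constr:(0%nat) | (RtoC 1, _) => constr:(1%nat)
          | _ => constr:(2%nat) end in
        let i := f a in let j := f b in
        exact (base_outer_triangles_separated i j z Ho Hc) end.
  - apply in_KS_S in He, He'.
    destruct He as [f [i [Hf [Hi ->]]]], He' as [f' [j [Hf' [Hj ->]]]].
    assert (f = f') as <-.
    { apply IH; [exact Hf|exact Hf'| |].
      - exact (outer_open_child _ _ _ Hi Ho).
      - exact (outer_closed_child _ _ _ Hj Hc). }
    destruct Ho as [x [y [Hx [Hy [Hxy Hz]]]]].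
    destruct Hc as [x' [y' [Hx' [Hy' [Hxy' Hz']]]]].
    rewrite Hz in Hz'. rewrite !pt_child in Hz' by assumption.
    apply pt_inj in Hz'; [|eapply vec_neq0; eauto].
    destruct i as [|[|[|[|]]]]; try lia; destruct j as [|[|[|[|]]]]; try lia;
      try reflexivity; cbn [child_x child_y] in Hz'; exfalso; lra.
Qed.

(** Avoiding the outer triangles, instead of only the curve, is the property that
    survives refinement: the next curve lies in the outer triangles of this
    one. *)
Definition free (n : nat) (z : C) : Prop :=
  forall f, In f (KS_sides n) -> ~ outer_closed f z.

Lemma free_S n z : free n z -> free (S n) z.
Proof.
  intros H f Hf Hc. apply in_KS_S in Hf. destruct Hf as [e [i [He [Hi ->]]]].
  apply (H e He). eapply outer_closed_child; eauto.
Qed.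

(** The open gap triangle of [e] lies in [outer_open e], which meets no other
    outer triangle, and it misses those of the four children of [e], which only
    touch its two outer edges and the ends of its base. *)
Lemma gap_free n e z : In e (KS_sides n) -> gap_open e z -> free (S n) z.
Proof.
  intros He [x [y [Hx [Hy [Hxy Hz]]]]] f Hf Hc.
  apply in_KS_S in Hf. destruct Hf as [e' [i [He' [Hi ->]]]].
  assert (e = e') as <-.
  { apply (outer_triangles_separated n e e' z He He').
    - exists x, y. repeat split; try lra; exact Hz.
    - eapply outer_closed_child; eauto. }
  destruct Hc as [x' [y' [Hx' [Hy' [Hxy' Hz']]]]].
  rewrite Hz in Hz'. rewrite !pt_child in Hz' by assumption.
  apply pt_inj in Hz'; [|eapply vec_neq0; eauto].
  destruct i as [|[|[|[|]]]]; try lia; cbn [child_x child_y] in Hz'; lra.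
Qed.

Lemma on_side_pt e z :
  on_side e z <-> exists x, 0 <= x <= 1 /\ z = pt e x 0.
Proof.
  unfold on_side.
  assert (E : forall x, ray (fst e) (Cminus (snd e) (fst e)) x = pt e x 0).
  { intros x. unfold ray, pt. rewrite Cmult_0_l, Cplus_0_r.
    now rewrite (Cmult_comm (RtoC x)). }
  split; intros [x [Hx Hz]]; exists x; split; auto; rewrite Hz;
    [apply E|symmetry; apply E].
Qed.

Lemma on_side_outer e z : on_side e z -> outer_closed e z.
Proof.
  rewrite on_side_pt. intros [x [Hx ->]]. exists x, 0. repeat split; lra.
Qed.

Lemma free_not_KS n z : free n z -> ~ KS n z.
Proof.
  intros H [e [He Hz]]. exact (H e He (on_side_outer _ _ Hz)).
Qed.

Lemma side_pt_outer_open p s : 0 < s < 1 -> outer_open (fst p) (side_pt p s).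
Proof. intros Hs. exists s, 0. repeat split; lra. Qed.

(** * Legs *)

(** The slope in [s] is [-1], [0] or [1] in units of the side: a leg shortens when
    both ends are even, is constant when the two sides are parallel (different
    parities), and grows when both are odd.  The parameter [lam] is its length at
    the midpoint. *)
Definition leg (n : nat) (p q : tside) (lam s : R) : R :=
  lam + / 3 ^ n * (s - 1/2) * (parity (snd p) + parity (snd q) - 1).

Definition link (n : nat) (p q : tside) (lam : R) : Prop :=
  out_dir n p = in_dir n q /\
  forall s, 0 < s < 1 ->
    0 < leg n p q lam s /\
    ray (side_pt p s) (out_dir n p) (leg n p q lam s) = side_pt q (1 - s) /\
    forall r, 0 < r < leg n p q lam s -> free n (ray (side_pt p s) (out_dir n p) r).

Lemma ray_ray z v a b : ray (ray z v a) v b = ray z v (a + b).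
Proof.
  destruct z, v. unfold ray. apply injective_projections; simpl; ring.
Qed.

Lemma ray_out_dir n p s r :
  ray (side_pt p s) (out_dir n p) r =
  pt (fst p) (s + (1 - parity (snd p)) * (3 ^ n * r)) (- (3 ^ n * r)).
Proof.
  destruct p as [e o]. unfold ray, side_pt, out_dir, pt. cbn [fst snd].
  fold (vec e). destruct (fst e) as [a1 a2], (vec e) as [v1 v2].
  generalize (parity o) as t, (3 ^ n) as m. intros t m. ceq.
Qed.

Lemma ray_in_dir n q s r :
  ray (side_pt q s) (in_dir n q) r =
  pt (fst q) (s - parity (snd q) * (3 ^ n * r)) (3 ^ n * r).
Proof.
  destruct q as [e o]. unfold ray, side_pt, in_dir, pt. cbn [fst snd].
  fold (vec e). destruct (fst e) as [a1 a2], (vec e) as [v1 v2].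
  generalize (parity o) as t, (3 ^ n) as m. intros t m. ceq.
Qed.

Lemma pow3_pos n : 0 < 3 ^ n.
Proof. apply pow_lt. lra. Qed.

(** The part of a leg between the gap and the first bounce inside the small
    triangle of an arriving trajectory; by symmetry also the part from the last
    bounce to the gap of a leaving one. *)
Definition gap_leg (n : nat) (p : tside) (s : R) : R :=
  / 3 ^ n / 3 * (1/2 + (1 - 2 * parity (snd p)) * (s - 1/2)).

Lemma gap_leg_eq n p s :
  3 ^ n * gap_leg n p s = if snd p then (1 - s) / 3 else s / 3.
Proof.
  unfold gap_leg. pose proof (pow3_pos n).
  destruct (snd p); cbn [parity]; field; lra.
Qed.

Lemma gap_leg_pos n p s : 0 < s < 1 -> 0 < gap_leg n p s.
Proof.
  intros Hs. apply (Rmult_lt_reg_l (3 ^ n)); [apply pow3_pos|].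
  rewrite gap_leg_eq. destruct (snd p); lra.
Qed.

Lemma side_pt_kid i p s : (i < 4)%nat ->
  side_pt (kid i p) s = pt (fst p) (child_x i s 0) (child_y i s 0).
Proof. intros Hi. unfold side_pt, kid. cbn [fst]. now apply pt_child. Qed.

Lemma side_pt_kid0 p s : side_pt (kid 0 p) s = side_pt p (s / 3).
Proof.
  rewrite side_pt_kid by lia. unfold side_pt. f_equal; simpl; lra.
Qed.

Lemma side_pt_kid3 p s : side_pt (kid 3 p) s = side_pt p (2 / 3 + s / 3).
Proof.
  rewrite side_pt_kid by lia. unfold side_pt. f_equal; simpl; lra.
Qed.

Lemma side_pt_out_kid n p s :
  side_pt (out_kid p) s =
  ray (side_pt p ((1 + s) / 3)) (out_dir n p) (- gap_leg n p s).
Proof.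
  rewrite ray_out_dir.
  replace (3 ^ n * - gap_leg n p s) with (- (3 ^ n * gap_leg n p s)) by ring.
  rewrite gap_leg_eq. unfold out_kid.
  destruct (snd p); rewrite side_pt_kid by lia; cbn [child_x child_y parity];
    f_equal; lra.
Qed.

Lemma side_pt_in_kid n q s :
  side_pt (in_kid q) (1 - s) =
  ray (side_pt q (1 - (1 + s) / 3)) (in_dir n q) (gap_leg n q s).
Proof.
  rewrite ray_in_dir, gap_leg_eq. unfold in_kid.
  destruct (snd q); rewrite side_pt_kid by lia; cbn [child_x child_y parity];
    f_equal; lra.
Qed.

Lemma leg_kid0 n p q lam s :
  leg (S n) (kid 0 p) (kid 3 q) (leg n p q lam (1/6)) s = leg n p q lam (s / 3).
Proof. unfold leg. cbn [kid snd pow]. pose proof (pow3_pos n). field. lra. Qed.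

Lemma leg_kid3 n p q lam s :
  leg (S n) (kid 3 p) (kid 0 q) (leg n p q lam (5/6)) s =
  leg n p q lam (2/3 + s / 3).
Proof. unfold leg. cbn [kid snd pow]. pose proof (pow3_pos n). field. lra. Qed.

(** An extreme child inherits the whole leg.  The reversal [s -> 1 - s] turns the
    first third of one side into the last third of the other. *)
Lemma link_kid0 n p q lam :
  link n p q lam -> link (S n) (kid 0 p) (kid 3 q) (leg n p q lam (1/6)).
Proof.
  intros [Hd H]. split; [rewrite out_dir_kid0, in_dir_kid3; exact Hd|].
  intros s Hs. destruct (H (s / 3) ltac:(lra)) as [H1 [H2 H3]].
  rewrite leg_kid0, out_dir_kid0, side_pt_kid0, side_pt_kid3.
  split; [exact H1|]. split.
  - rewrite H2. f_equal. lra.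
  - intros r Hr. apply free_S, H3, Hr.
Qed.

Lemma link_kid3 n p q lam :
  link n p q lam -> link (S n) (kid 3 p) (kid 0 q) (leg n p q lam (5/6)).
Proof.
  intros [Hd H]. split; [rewrite out_dir_kid3, in_dir_kid0; exact Hd|].
  intros s Hs. destruct (H (2/3 + s / 3) ltac:(lra)) as [H1 [H2 H3]].
  rewrite leg_kid3, out_dir_kid3, side_pt_kid0, side_pt_kid3.
  split; [exact H1|]. split.
  - rewrite H2. f_equal. lra.
  - intros r Hr. apply free_S, H3, Hr.
Qed.

(** The leg inside the small triangle: it is parallel to the gap and never leaves
    the triangle. *)
Lemma link_in_out n p :
  tagged n p -> link (S n) (in_kid p) (out_kid p) (/ 3 ^ n / 6).
Proof.
  intros [Hp _]. split; [symmetry; apply in_dir_out_kid|].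
  intros s Hs. pose proof (pow3_pos n) as Hn.
  assert (E : 3 ^ n * leg (S n) (in_kid p) (out_kid p) (/ 3 ^ n / 6) s
              = if snd p then (1 - s) / 3 else s / 3).
  { unfold leg, in_kid, out_kid, kid. destruct (snd p);
      cbn [snd negb parity pow]; field; lra. }
  assert (K : forall r, ray (side_pt (in_kid p) s) (out_dir (S n) (in_kid p)) r =
     if snd p then pt (fst p) (1/3 + 3 ^ n * r) (s / 3)
     else pt (fst p) (1/3 + s / 3 - 3 ^ n * r) (1/3 - s / 3)).
  { intros r. rewrite out_dir_in_kid. unfold in_kid.
    destruct p as [e []]; cbn [snd]; rewrite side_pt_kid by lia;
      cbn [child_x child_y fst parity]; unfold ray, pt;
      fold (vec e); destruct (fst e), (vec e); ceq. }
  assert (Hl : 0 < leg (S n) (in_kid p) (out_kid p) (/ 3 ^ n / 6) s).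
  { apply (Rmult_lt_reg_l (3 ^ n)); [exact Hn|]. rewrite E.
    destruct (snd p); lra. }
  split; [exact Hl|]. split.
  - rewrite K, E. unfold out_kid.
    destruct (snd p); rewrite side_pt_kid by lia; cbn [child_x child_y];
      f_equal; lra.
  - intros r [Hr0 Hr1]. rewrite K.
    apply (Rmult_lt_compat_l (3 ^ n)) in Hr0, Hr1; try exact Hn.
    rewrite E in Hr1. rewrite Rmult_0_r in Hr0.
    apply (gap_free n (fst p) _ Hp).
    destruct (snd p);
      [exists (1/3 + 3 ^ n * r), (s / 3)
      |exists (1/3 + s / 3 - 3 ^ n * r), (1/3 - s / 3)];
      repeat split; lra.
Qed.

Lemma leg_out_in n p q lam s :
  leg (S n) (out_kid p) (in_kid q) (lam + / 3 ^ n / 3) s =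
  gap_leg n p s + leg n p q lam ((1 + s) / 3) + gap_leg n q s.
Proof.
  pose proof (pow3_pos n). unfold leg, gap_leg, out_kid, in_kid, kid.
  destruct (snd p), (snd q); cbn [snd negb parity pow]; field; lra.
Qed.

(** The leg leaves the small triangle on [p] through the gap, follows an old leg,
    and enters the small triangle on [q] through its gap.  The two additional
    pieces turn the factor [o + o' - 1] of the slope into its opposite, as they
    should, since both parities have been switched. *)
Lemma link_out_in n p q lam :
  tagged n p -> tagged n q -> link n p q lam ->
  link (S n) (out_kid p) (in_kid q) (lam + / 3 ^ n / 3).
Proof.
  intros [Hp _] [Hq _] [Hd H].
  split; [rewrite out_dir_out_kid, in_dir_in_kid; exact Hd|].
  intros s Hs. destruct (H ((1 + s) / 3) ltac:(lra)) as [H1 [H2 H3]].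
  pose proof (pow3_pos n) as Hn.
  pose proof (gap_leg_pos n p s Hs) as Gp.
  pose proof (gap_leg_pos n q s Hs) as Gq.
  set (l := leg n p q lam ((1 + s) / 3)) in *.
  rewrite leg_out_in, out_dir_out_kid, (side_pt_out_kid n p). fold l.
  split; [lra|]. split.
  - rewrite ray_ray.
    replace (- gap_leg n p s + (gap_leg n p s + l + gap_leg n q s))
      with (l + gap_leg n q s) by ring.
    now rewrite <- ray_ray, H2, Hd, <- side_pt_in_kid.
  (* The time [t] is counted from the passage through the gap of [p]; the cases
     are the gap triangle of [p], the old leg, and the gap triangle of [q]. *)
  - intros r Hr. rewrite ray_ray. set (t := - gap_leg n p s + r).
    destruct (Rle_lt_dec t 0) as [Ht|Ht];
      [|destruct (Rlt_le_dec t l) as [Ht'|Ht']].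
    + rewrite ray_out_dir. apply (gap_free n (fst p) _ Hp).
      assert (0 <= 3 ^ n * (- t)) by (apply Rmult_le_pos; lra).
      assert (3 ^ n * (- t) < 3 ^ n * gap_leg n p s)
        by (apply Rmult_lt_compat_l; [lra|unfold t; lra]).
      rewrite gap_leg_eq in *.
      exists ((1 + s) / 3 + (1 - parity (snd p)) * (3 ^ n * t)), (- (3 ^ n * t)).
      destruct (snd p); cbn [parity]; repeat split; lra.
    + apply free_S, H3. lra.
    + replace t with (l + (t - l)) by ring.
      rewrite <- ray_ray, H2, Hd, ray_in_dir.
      apply (gap_free n (fst q) _ Hq).
      assert (0 <= 3 ^ n * (t - l)) by (apply Rmult_le_pos; lra).
      assert (3 ^ n * (t - l) < 3 ^ n * gap_leg n q s)
        by (apply Rmult_lt_compat_l; [lra|unfold t; lra]).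
      rewrite gap_leg_eq in *.
      exists (1 - (1 + s) / 3 - parity (snd q) * (3 ^ n * (t - l))), (3 ^ n * (t - l)).
      destruct (snd q); cbn [parity]; repeat split; lra.
Qed.

Lemma base_link i : (i < 3)%nat ->
  link 0 (base_side i) (base_side (S i mod 3)) (1 / 2).
Proof.
  intros Hi.
  assert (Hl : forall s, leg 0 (base_side i) (base_side (S i mod 3)) (1/2) s = 1 - s).
  { intros s. unfold leg, base_side. cbn [snd parity pow]. field. }
  split.
  - unfold out_dir, in_dir, base_side, vec.
    destruct i as [|[|[|]]]; try lia;
      cbn [fst snd Nat.modulo Nat.divmod Nat.sub parity pow]; ceq.
  - intros s Hs. rewrite Hl. split; [lra|]. split.
    + rewrite ray_out_dir. unfold side_pt. rewrite !base_coords.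
      assert (K : forall u v u' v', u = u' -> v = v' ->
        Cplus (RtoC u) (Cmult (RtoC v) omega) =
        Cplus (RtoC u') (Cmult (RtoC v') omega)) by (intros; subst; reflexivity).
      destruct i as [|[|[|]]]; try lia; simpl; apply K; lra.
    + intros r Hr f Hf [x [y [Hx [Hy [Hxy Hz]]]]].
      rewrite ray_out_dir in Hz. unfold base_side in Hz at 2. cbn [snd parity pow] in Hz.
      rewrite base_coords in Hz.
      assert (exists j, (j < 3)%nat /\ f = fst (base_side j)) as [j [Hj ->]].
      { destruct Hf as [<-|[<-|[<-|[]]]];
          [exists 0%nat|exists 1%nat|exists 2%nat]; split; auto. }
      rewrite base_coords in Hz.
      destruct i as [|[|[|]]]; try lia; destruct j as [|[|[|]]]; try lia;
        apply omega_coords_inj in Hz; lra.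
Qed.

(** Links exist from all sides, not only those met by the orbit in question; this
    is what rules out a wrong starting point in [start_unique]. *)
Lemma exists_link n e : In e (KS_sides n) ->
  exists o q lam, tagged n (e, o) /\ tagged n q /\ link n (e, o) q lam.
Proof.
  revert e; induction n as [|n IH]; intros e He.
  - assert (exists i, (i < 3)%nat /\ e = fst (base_side i)) as [i [Hi ->]].
    { destruct He as [<-|[<-|[<-|[]]]];
        [exists 0%nat|exists 1%nat|exists 2%nat]; split; auto. }
    exists false, (base_side (S i mod 3)), (1/2).
    split; [apply (base_side_tagged i)|].
    split; [apply base_side_tagged|apply base_link, Hi].
  - destruct (child_cases _ _ He) as [e' [He' Hc]].
    destruct (IH _ He') as [o [q [lam [Tp [Tq L]]]]].
    assert (X : forall p q' lam', tagged (S n) p -> tagged (S n) q' ->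
              link (S n) p q' lam' -> e = fst p ->
              exists o q lam, tagged (S n) (e, o) /\ tagged (S n) q /\
                              link (S n) (e, o) q lam).
    { intros [f t] q' lam' ? ? ? ->. exists t, q', lam'. auto. }
    destruct (Hc o) as [H|[H|[H|H]]].
    + refine (X _ _ _ _ _ _ H); [| |apply link_kid0; exact L];
        auto using tagged_kid0, tagged_kid3.
    + refine (X _ _ _ _ _ _ H); [| |apply link_kid3; exact L];
        auto using tagged_kid0, tagged_kid3.
    + refine (X _ _ _ _ _ _ H); [| |apply link_in_out; exact Tp];
        auto using tagged_in_kid, tagged_out_kid.
    + refine (X _ _ _ _ _ _ H); [| |apply link_out_in; [exact Tp|exact Tq|exact L]];
        auto using tagged_in_kid, tagged_out_kid.
Qed.

(** * One step of the billiard map *)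

Lemma reflect_in_dir n q : tagged n q ->
  reflect_dir (fst q) (in_dir n q) = out_dir n q.
Proof.
  intros [Hq _]. pose proof (vec_neq0 _ _ Hq) as Hv.
  unfold reflect_dir, in_dir, out_dir. fold (vec (fst q)).
  destruct (vec (fst q)) as [u1 u2].
  assert (Hu : u1 * u1 + u2 * u2 <> 0).
  { intros H. apply Hv. unfold RtoC. f_equal; nra. }
  generalize (parity (snd q)) as t, (3 ^ n) as m. intros t m. ceq; nra.
Qed.

Lemma link_hit n p q lam s : tagged n q -> link n p q lam -> 0 < s < 1 ->
  KS n (ray (side_pt p s) (out_dir n p) (leg n p q lam s)).
Proof.
  intros [Hq _] [_ H] Hs. destruct (H s Hs) as [_ [-> _]].
  exists (fst q). split; [exact Hq|]. apply on_side_pt.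
  exists (1 - s). split; [lra|reflexivity].
Qed.

(** The billiard map chooses some next state; here the hitting time is forced
    because the leg is free of the curve, and the side that is hit is the only
    one through the point of arrival, which is not a vertex. *)
Lemma billiard_map_link n p q lam s :
  tagged n q -> link n p q lam -> 0 < s < 1 ->
  billiard_map n (side_pt p s, out_dir n p) = (side_pt q (1 - s), out_dir n q).
Proof.
  intros Tq L Hs. pose proof (link_hit n p q lam s Tq L Hs) as Hhit.
  destruct L as [Hd H]. destruct (H s Hs) as [H1 [H2 H3]].
  set (l := leg n p q lam s) in *.
  assert (Hex : billiard_step n (side_pt p s, out_dir n p) (side_pt q (1 - s), out_dir n q)).
  { split; cbn [fst snd].
    - exists l. split; [exact H1|]. split; [now rewrite H2|].
      split; [rewrite <- H2; exact Hhit|].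
      intros r Hr. apply free_not_KS, H3, Hr.
    - exists (fst q). split; [apply Tq|]. split.
      + apply on_side_pt. exists (1 - s). split; [lra|reflexivity].
      + now rewrite Hd, reflect_in_dir. }
  assert (Hun : forall st, billiard_step n (side_pt p s, out_dir n p) st ->
                           st = (side_pt q (1 - s), out_dir n q)).
  { intros [z v] [[t [Ht0 [Ht [HK Hf]]]] [e [He [Hon Hv]]]].
    cbn [fst snd] in *.
    assert (t = l) as ->.
    { destruct (Rtotal_order t l) as [Hlt|[Heq|Hgt]]; [|exact Heq|].
      - exfalso. rewrite Ht in HK.
        apply (free_not_KS n _ (H3 t (conj Ht0 Hlt))), HK.
      - exfalso. apply (Hf l); [lra|exact Hhit]. }
    rewrite H2 in Ht. subst z.
    assert (fst q = e) as <-.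
    { apply (outer_triangles_separated n _ _ (side_pt q (1 - s)));
        [apply Tq|exact He| |].
      - apply side_pt_outer_open. lra.
      - apply on_side_outer, Hon. }
    rewrite Hv, Hd, reflect_in_dir by exact Tq. reflexivity. }
  apply Hun. unfold billiard_map. apply epsilon_spec. eexists; exact Hex.
Qed.

(** * Itineraries *)

(** The relative position after [i] bounces, each of which maps [s] to
    [1 - s]. *)
Definition alternate (s : R) (i : nat) : R := if Nat.even i then s else 1 - s.

Definition itinerary (n : nat) (E : nat -> tside) (lam : nat -> R) : Prop :=
  forall i, tagged n (E i) /\ link n (E i) (E (S i)) (lam i).

Lemma alternate_S s i : alternate s (S i) = 1 - alternate s i.
Proof.
  unfold alternate. rewrite Nat.even_succ, <- Nat.negb_even.
  destruct (Nat.even i); simpl; lra.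
Qed.

Lemma alternate_range s i : 0 < s < 1 -> 0 < alternate s i < 1.
Proof. intros Hs. unfold alternate. destruct (Nat.even i); lra. Qed.

Definition itin_state (n : nat) (E : nat -> tside) (s : R) (i : nat) : state :=
  (side_pt (E i) (alternate s i), out_dir n (E i)).

Lemma orbit_pt_itinerary n E lam s k :
  itinerary n E lam -> 0 < s < 1 ->
  orbit_pt n (itin_state n E s 0) k = itin_state n E s k.
Proof.
  intros HE Hs. induction k as [|k IH]; [reflexivity|].
  change (orbit_pt n (itin_state n E s 0) (S k))
    with (billiard_map n (orbit_pt n (itin_state n E s 0) k)).
  rewrite IH. unfold itin_state.
  rewrite alternate_S.
  apply (billiard_map_link n (E k) (E (S k)) (lam k)).
  - apply HE.
  - apply HE.
  - apply alternate_range, Hs.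
Qed.

Lemma Cmod_itin_step n E lam s k :
  itinerary n E lam -> 0 < s < 1 ->
  Cmod (Cminus (fst (itin_state n E s (S k))) (fst (itin_state n E s k))) =
  leg n (E k) (E (S k)) (lam k) (alternate s k).
Proof.
  intros HE Hs. unfold itin_state. cbn [fst]. rewrite alternate_S.
  destruct (HE k) as [T [_ H]].
  destruct (H _ (alternate_range s k Hs)) as [H1 [H2 _]].
  rewrite <- H2. unfold ray.
  set (l := leg _ _ _ _ _) in *. set (z := side_pt _ _). set (v := out_dir _ _).
  replace (Cminus (Cplus z (Cmult (RtoC l) v)) z) with (Cmult (RtoC l) v) by ring.
  rewrite Cmod_mult, Cmod_R. unfold v. rewrite Cmod_out_dir by exact T.
  rewrite Rabs_pos_eq; lra.
Qed.

(** * Period *)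

Lemma cardinal_range (T : Type) (p : nat -> T) (M : nat) :
  (forall i j, (i < M)%nat -> (j < M)%nat -> p i = p j -> i = j) ->
  cardinal T (fun q => exists i, (i < M)%nat /\ q = p i) M.
Proof.
  induction M as [|M IH]; intros Hinj.
  - replace (fun q => exists i, (i < 0)%nat /\ q = p i) with (Empty_set T).
    + constructor.
    + apply Extensionality_Ensembles; split; intros q Hq;
        [destruct Hq|destruct Hq as [i [Hi _]]; lia].
  - replace (fun q => exists i, (i < S M)%nat /\ q = p i)
      with (Ensembles.Add T (fun q => exists i, (i < M)%nat /\ q = p i) (p M)).
    + apply card_add.
      * apply IH. intros i j Hi Hj. apply Hinj; lia.
      * intros [i [Hi Hp]]. assert (M = i) by (apply Hinj; [lia|lia|exact Hp]). lia.
    + apply Extensionality_Ensembles; split; intros q Hq.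
      * destruct Hq as [q [i [Hi ->]]|q []].
        -- exists i. split; [lia|reflexivity].
        -- exists M. split; [lia|reflexivity].
      * destruct Hq as [i [Hi ->]].
        destruct (Nat.eq_dec i M) as [->|Hne].
        -- right. constructor.
        -- left. exists i. split; [lia|reflexivity].
Qed.

(** The period is an arbitrary choice among the cardinals of the orbit; it is
    pinned down by the uniqueness of cardinals. *)
Lemma period_orbit n st (p : nat -> state) (M : nat) :
  (0 < M)%nat ->
  (forall k, orbit_pt n st k = p k) ->
  (forall k, p k = p (k mod M)%nat) ->
  (forall i j, (i < M)%nat -> (j < M)%nat -> p i = p j -> i = j) ->
  period n st = M.
Proof.
  intros HM Horb Hper Hinj.
  assert (Hc : cardinal state (orbit n st) M).
  { replace (orbit n st) with (fun q => exists i, (i < M)%nat /\ q = p i).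
    - apply cardinal_range, Hinj.
    - apply Extensionality_Ensembles; split; intros q [i Hq].
      + exists i. rewrite Horb. apply Hq.
      + exists (i mod M)%nat. split; [apply Nat.mod_upper_bound; lia|].
        rewrite <- Hper, <- Horb. exact Hq. }
  unfold period. apply (cardinal_unicity state (orbit n st)); [|exact Hc].
  apply epsilon_spec. exists M. exact Hc.
Qed.

(** * Refining an itinerary *)

(** Refinement for the digit 0 ([c = false]) or 2 ([c = true]): positions alternate
    between [s] and [1 - s], hence so do the first and the last third.  The
    midpoints of these thirds are at 1/6 and 5/6. *)
Definition outer_sides (c : bool) (E : nat -> tside) (i : nat) : tside :=
  kid (if Bool.eqb c (Nat.even i) then 3 else 0) (E i).

Definition outer_lengths (n : nat) (c : bool) (E : nat -> tside)
  (lam : nat -> R) (i : nat) : R :=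
  leg n (E i) (E (S i)) (lam i) (alternate (if c then 5/6 else 1/6) i).

(** Refinement for the digit 1.  Each old bounce becomes two, first on the in-kid
    and then on the out-kid, but the starting point has moved back to the
    out-kid of the first side; hence the shift of the odd terms. *)
Definition middle_sides (E : nat -> tside) (i : nat) : tside :=
  if Nat.even i then out_kid (E (Nat.div2 i)) else in_kid (E (S (Nat.div2 i))).

Definition middle_lengths (n : nat) (lam : nat -> R) (i : nat) : R :=
  if Nat.even i then lam (Nat.div2 i) + / 3 ^ n / 3 else / 3 ^ n / 6.

Lemma outer_itinerary n c E lam : itinerary n E lam ->
  itinerary (S n) (outer_sides c E) (outer_lengths n c E lam).
Proof.
  intros HE i. destruct (HE i) as [T L].
  unfold outer_sides, outer_lengths, alternate.
  rewrite Nat.even_succ, <- Nat.negb_even.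
  destruct c, (Nat.even i); cbn [negb Bool.eqb]; split;
    auto using tagged_kid0, tagged_kid3.
  - apply link_kid3, L.
  - replace (1 - 5/6) with (1/6) by lra. apply link_kid0, L.
  - apply link_kid0, L.
  - replace (1 - 1/6) with (5/6) by lra. apply link_kid3, L.
Qed.

Lemma middle_itinerary n E lam : itinerary n E lam ->
  itinerary (S n) (middle_sides E) (middle_lengths n lam).
Proof.
  intros HE i. unfold middle_sides, middle_lengths.
  rewrite Nat.even_succ, <- Nat.negb_even.
  destruct (Nat.Even_or_Odd i) as [[j ->]|[j ->]].
  - rewrite Nat.even_even, Nat.div2_double, Nat.div2_succ_double. cbn [negb].
    split; [apply tagged_out_kid, HE|]. apply link_out_in; apply HE.
  - rewrite Nat.even_odd, Nat.add_1_r, Nat.div2_succ_double. cbn [negb].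
    replace (Nat.div2 (S (S (2 * j)))) with (S j)
      by (change (Nat.div2 (S (S (2 * j)))) with (S (Nat.div2 (2 * j)));
          now rewrite Nat.div2_double).
    split; [apply tagged_in_kid, HE|]. apply link_in_out, HE.
Qed.

Lemma child_inj n e e' i j :
  In e (KS_sides n) -> In e' (KS_sides n) -> (i < 4)%nat -> (j < 4)%nat ->
  child i e = child j e' -> e = e' /\ i = j.
Proof.
  intros He He' Hi Hj H.
  assert (Hm : outer_open (child i e) (pt (child i e) (1/2) 0)).
  { exists (1/2), 0. repeat split; lra. }
  assert (e = e') as <-.
  { apply (outer_triangles_separated n e e' (pt (child i e) (1/2) 0)); auto.
    - apply (outer_open_child i); auto.
    - rewrite H. apply (outer_closed_child j); auto.
      exists (1/2), 0. repeat split; lra. }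
  split; [reflexivity|].
  assert (K : pt (child i e) (1/2) 0 = pt (child j e) (1/2) 0) by now rewrite H.
  rewrite !pt_child in K by assumption.
  apply pt_inj in K; [|eapply vec_neq0; eauto].
  destruct i as [|[|[|[|]]]]; try lia; destruct j as [|[|[|[|]]]]; try lia;
    cbn [child_x child_y] in K; lra.
Qed.

Definition cyclic (E : nat -> tside) (M : nat) : Prop :=
  (0 < M)%nat /\ (forall i, E i = E (i mod M)%nat) /\
  forall i j, fst (E i) = fst (E j) -> (i mod M = j mod M)%nat.

Lemma cyclic_congr E M i j : cyclic E M -> (i mod M = j mod M)%nat -> E i = E j.
Proof. intros [_ [H _]] Hij. now rewrite (H i), (H j), Hij. Qed.

Lemma even_mod i N : Nat.even N = true -> N <> 0%nat ->
  Nat.even (i mod N) = Nat.even i.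
Proof.
  intros HN H0. rewrite (Nat.div_mod_eq i N) at 2.
  rewrite Nat.even_add, Nat.even_mul, HN. cbn [orb].
  now destruct (Nat.even (i mod N)).
Qed.

(** The extreme child depends on the side and on the parity of the time, so the
    new cycle length is a multiple of the old one that is even. *)
Lemma outer_cyclic n c E lam M k :
  itinerary n E lam -> cyclic E M -> Nat.even (M * k) = true -> k <> 0%nat ->
  (forall i j, (i mod M = j mod M)%nat -> Nat.even i = Nat.even j ->
               (i mod (M * k) = j mod (M * k))%nat) ->
  cyclic (outer_sides c E) (M * k).
Proof.
  intros HE [HM [HA HB]] Hev Hk HC. split; [nia|]. split.
  - intros i. unfold outer_sides. rewrite even_mod by (auto; nia).
    rewrite (cyclic_congr E M i (i mod (M * k))); auto.
    { split; auto. }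
    rewrite Nat.Div0.mod_mul_r, Nat.mul_comm, Nat.Div0.mod_add.
    now rewrite Nat.Div0.mod_mod.
  - intros i j H. unfold outer_sides, kid in H. cbn [fst] in H.
    apply (child_inj n) in H; [|apply HE|apply HE| |];
      [|destruct (Bool.eqb c (Nat.even i)); lia
       |destruct (Bool.eqb c (Nat.even j)); lia].
    destruct H as [H1 H2]. apply HC; [apply HB, H1|].
    destruct c, (Nat.even i), (Nat.even j); simpl in H2; congruence.
Qed.

(** Each side of the old cycle is replaced by two of its children, and an in-kid
    is never an out-kid; an odd cycle therefore doubles like an even one. *)
Lemma middle_cyclic n E lam M :
  itinerary n E lam -> cyclic E M -> cyclic (middle_sides E) (2 * M).
Proof.
  intros HE Hcyc. pose proof Hcyc as [HM [HA HB]].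
  assert (Hs : forall a b, (a mod M = b mod M -> S a mod M = S b mod M)%nat).
  { intros a b H. rewrite <- (Nat.add_1_r a), <- (Nat.add_1_r b).
    rewrite (Nat.Div0.add_mod a), (Nat.Div0.add_mod b). now rewrite H. }
  assert (Hm0 : forall j, ((2 * j) mod (2 * M) = 2 * (j mod M))%nat).
  { intros j. apply Nat.Div0.mul_mod_distr_l. }
  assert (Hm1 : forall j, ((2 * j + 1) mod (2 * M) = 2 * (j mod M) + 1)%nat).
  { intros j. rewrite Nat.Div0.mod_mul_r.
    replace ((2 * j + 1) / 2)%nat with j.
    2:{ rewrite Nat.mul_comm, Nat.div_add_l by lia. simpl. lia. }
    replace ((2 * j + 1) mod 2)%nat with 1%nat.
    2:{ rewrite Nat.add_comm, Nat.mul_comm, Nat.Div0.mod_add. reflexivity. }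
    lia. }
  assert (E0 : forall j, middle_sides E (2 * j) = out_kid (E j)).
  { intros j. unfold middle_sides. now rewrite Nat.even_even, Nat.div2_double. }
  assert (E1 : forall j, middle_sides E (2 * j + 1) = in_kid (E (S j))).
  { intros j. unfold middle_sides.
    now rewrite Nat.even_odd, Nat.add_1_r, Nat.div2_succ_double. }
  assert (Hno : forall i j, fst (out_kid (E i)) = fst (in_kid (E j)) -> False).
  { intros i j H. unfold out_kid, in_kid, kid in H. cbn [fst] in H.
    apply (child_inj n) in H;
      [|apply HE|apply HE|destruct (snd (E i)); lia|destruct (snd (E j)); lia].
    destruct H as [H1 H2].
    rewrite (cyclic_congr E M i j Hcyc (HB _ _ H1)) in H2.
    destruct (snd (E j)); discriminate. }
  split; [lia|]. split.
  - intros i. destruct (Nat.Even_or_Odd i) as [[j ->]|[j ->]].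
    + rewrite Hm0, !E0. f_equal. apply HA.
    + rewrite Hm1, !E1. f_equal. apply (cyclic_congr E M _ _ Hcyc).
      apply Hs. now rewrite Nat.Div0.mod_mod.
  - intros i j H. destruct (Nat.Even_or_Odd i) as [[i' ->]|[i' ->]],
      (Nat.Even_or_Odd j) as [[j' ->]|[j' ->]]; rewrite ?E0, ?E1 in H.
    + rewrite !Hm0. f_equal. apply HB.
      unfold out_kid, kid in H. cbn [fst] in H.
      apply (child_inj n) in H;
        [apply H|apply HE|apply HE
        |destruct (snd (E i')); lia|destruct (snd (E j')); lia].
    + exfalso. exact (Hno _ _ H).
    + exfalso. exact (Hno _ _ (eq_sym H)).
    + rewrite !Hm1. do 2 f_equal.
      assert (K : (S i' mod M = S j' mod M)%nat).
      { apply HB. unfold in_kid, kid in H. cbn [fst] in H.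
        apply (child_inj n) in H;
          [apply H|apply HE|apply HE
          |destruct (snd (E (S i'))); lia|destruct (snd (E (S j'))); lia]. }
      assert (K' : ((S i' + (M - 1)) mod M = (S j' + (M - 1)) mod M)%nat).
      { rewrite (Nat.Div0.add_mod (S i')), (Nat.Div0.add_mod (S j')).
        now rewrite K. }
      replace (S i' + (M - 1))%nat with (i' + 1 * M)%nat in K' by lia.
      replace (S j' + (M - 1))%nat with (j' + 1 * M)%nat in K' by lia.
      now rewrite !Nat.Div0.mod_add in K'.
Qed.

(** * Lengths *)

Fixpoint total (f : nat -> R) (N : nat) : R :=
  match N with O => 0 | S m => total f m + f m end.

Lemma sum_n_m_total f N :
  sum_n_m (fun k => f (k - 1)%nat) 1 N = total f N.
Proof.
  induction N as [|N IH].
  - rewrite sum_n_m_zero by lia. reflexivity.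
  - rewrite sum_n_Sm by lia. rewrite IH. simpl. now rewrite Nat.sub_0_r.
Qed.

(** Over an even number of bounces the dependence on the position cancels: the
    deviation of the [i]-th leg from its midpoint length is, up to the factor
    [3^-n], [x i - x (i+1)] for the quantity [x] in the proof. *)
Lemma total_leg n E lam s N :
  Nat.even N = true -> snd (E N) = snd (E 0%nat) ->
  total (fun i => leg n (E i) (E (S i)) (lam i) (alternate s i)) N = total lam N.
Proof.
  intros HN HE.
  set (x := fun i => (alternate s i - 1/2) * (parity (snd (E i)) - 1/2)).
  assert (K : forall k,
    total (fun i => leg n (E i) (E (S i)) (lam i) (alternate s i)) k
    = total lam k + / 3 ^ n * (x 0%nat - x k)).
  { induction k as [|k IH]; simpl total; [ring|]. rewrite IH.
    unfold x, leg. rewrite (alternate_S s k). field. apply Rgt_not_eq, pow3_pos. }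
  rewrite K. unfold x. rewrite HE. unfold alternate. rewrite HN. cbn [Nat.even]. ring.
Qed.

(** Each old leg grows by a third of the old side, and each bounce inserts a leg
    whose midpoint length is a sixth of it. *)
Lemma total_middle n lam N :
  total (middle_lengths n lam) (2 * N) = total lam N + INR N * (/ 3 ^ n / 2).
Proof.
  induction N as [|N IH]; [simpl; ring|].
  replace (2 * S N)%nat with (S (S (2 * N))) by lia.
  cbn [total]. rewrite IH. unfold middle_lengths.
  rewrite Nat.even_even, Nat.even_succ, Nat.odd_even, Nat.div2_double, S_INR.
  pose proof (pow3_pos n). field. lra.
Qed.

(** * The starting point *)

Lemma vec_out_dir n p :
  vec (fst p) = Cmult (RtoC (/ 3 ^ n))
    (Cmult (out_dir n p) (if snd p then Cminus w (RtoC 1) else w)).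
Proof.
  pose proof (pow3_pos n) as Hn. unfold out_dir.
  destruct p as [e []]; cbn [fst snd parity]; destruct (vec e) as [v1 v2];
    generalize dependent (3 ^ n); intros m Hm; ceq; lra.
Qed.

(** The other two of the three directions can be outgoing at a side only if PI/3
    is parallel to that side or points outward there. *)
Lemma inward_out_dir n p : tagged n p -> inward (fst p) omega -> out_dir n p = omega.
Proof.
  intros [_ H] Hin. unfold inward in Hin. fold (vec (fst p)) in Hin.
  rewrite (vec_out_dir n p) in Hin. pose proof (pow3_pos n) as Hn.
  apply Rinv_0_lt_compat in Hn. set (m := / 3 ^ n) in *. clearbody m.
  destruct H as [H|[H|H]]; [exact H| |]; exfalso; rewrite H in Hin;
    unfold omega in Hin; rewrite ?w_pair, omega_pair in Hin;
    pose proof (sqrt_sqrt 3 ltac:(lra)) as Hk;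
    pose proof (sqrt_lt_R0 3 ltac:(lra)) as Hk0;
    generalize dependent (sqrt 3); intros k Hin Hk Hk0;
    assert (0 < m * k) by (apply Rmult_lt_0_compat; assumption);
    destruct (snd p); simpl in Hin;
    match type of Hin with 0 < ?X =>
      first [ assert (X = 0) by (field [Hk]); lra
            | assert (X = - (m * k / 2)) by (field [Hk]); lra ] end.
Qed.

Lemma in_dir_not_inward n p : ~ inward (fst p) (in_dir n p).
Proof.
  intros H. unfold inward, in_dir in H. fold (vec (fst p)) in H.
  destruct (vec (fst p)) as [u1 u2].
  rewrite w_pair in H. pose proof (pow3_pos n) as Hn.
  pose proof (sqrt_lt_R0 3 ltac:(lra)) as Hk.
  set (k := sqrt 3) in *. set (m := 3 ^ n) in *. clearbody k m.
  assert (E : Im (Cmult (Cconj (u1, u2)) (Cmult (RtoC m) (Cmult (u1, u2)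
     (Cminus (1 / 2, - (k / 2)) (RtoC (parity (snd p)))))))
     = - (m * k * (u1 * u1 + u2 * u2) / 2)).
  { unfold Im, Cmult, Cminus, Cplus, Copp, Cconj, RtoC. simpl. field. }
  rewrite E in H. assert (0 < m * k) by (apply Rmult_lt_0_compat; lra).
  nra.
Qed.

(** The orbit starts at distance [t] behind the point [a] of the base, and [a] is
    passed before the end of the first leg. *)
Definition started (n : nat) (E : nat -> tside) (lam : nat -> R)
  (a s t : R) : Prop :=
  side_pt (E 0%nat) s = ray (RtoC a) omega (- t) /\ out_dir n (E 0%nat) = omega /\
  0 <= t < leg n (E 0%nat) (E 1%nat) (lam 0%nat) s.

Lemma outer_started n (c : bool) E lam a s t :
  started n E lam a (if c then 2/3 + s/3 else s/3) t ->
  started (S n) (outer_sides c E) (outer_lengths n c E lam) a s t.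
Proof.
  unfold started, outer_sides, outer_lengths, alternate. cbn [Nat.even].
  destruct c; cbn [Bool.eqb].
  - rewrite side_pt_kid3, out_dir_kid3, leg_kid3. auto.
  - rewrite side_pt_kid0, out_dir_kid0, leg_kid0. auto.
Qed.

(** The start moves back from the gap to the boundary of the small triangle. *)
Lemma middle_started n E lam a s t : 0 < s < 1 ->
  started n E lam a ((1 + s) / 3) t ->
  started (S n) (middle_sides E) (middle_lengths n lam) a s
          (t + gap_leg n (E 0%nat) s).
Proof.
  unfold started, middle_sides, middle_lengths. cbn [Nat.even Nat.div2].
  intros Hs [H1 [H2 H3]].
  rewrite (side_pt_out_kid n), out_dir_out_kid, leg_out_in, H2, H1, ray_ray.
  pose proof (gap_leg_pos n (E 0%nat) s Hs).
  pose proof (gap_leg_pos n (E 1%nat) s Hs).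
  split; [f_equal; ring|]. split; [reflexivity|lra].
Qed.

Lemma on_side_nonvertex n e z : In e (KS_sides n) -> on_side e z ->
  ~ KS_vertex n z -> exists x, 0 < x < 1 /\ z = pt e x 0.
Proof.
  intros He Hz Hv. apply on_side_pt in Hz. destruct Hz as [x [Hx ->]].
  exists x. split; [|reflexivity].
  destruct (Req_dec x 0) as [->|H0].
  { exfalso. apply Hv. exists e. split; [exact He|left]. unfold pt.
    destruct (fst e), (snd e). apply injective_projections; simpl; ring. }
  destruct (Req_dec x 1) as [->|H1]; [|lra].
  exfalso. apply Hv. exists e. split; [exact He|right]. unfold pt.
  destruct (fst e), (snd e). apply injective_projections; simpl; ring.
Qed.

(** Suppose the visible point [z] were a different one.  If it lies in front, it
    can only be the end of the first leg, where PI/3 points outward.  If it lies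
    behind, the known start would block the view, unless that start is the base
    point itself; then the leg that issues from [z] reaches the base point through
    the outer triangle of the first side, which legs avoid. *)
Lemma start_unique n E lam a s t z tz :
  itinerary n E lam -> 0 < s < 1 -> started n E lam a s t ->
  phase_point n (z, omega) -> ~ KS_vertex n z ->
  z = ray (RtoC a) omega tz ->
  (forall r, Rmin 0 tz < r < Rmax 0 tz -> ~ KS n (ray (RtoC a) omega r)) ->
  z = side_pt (E 0%nat) s.
Proof.
  intros HE Hs [Hy [Hd Ht]] [_ [e [He [Hon Hin]]]] Hnv Hz Hvis.
  cbn [fst snd] in *.
  destruct (HE 0%nat) as [T0 L0]. destruct (HE 1%nat) as [T1 _].
  pose proof (link_hit _ _ _ _ s T1 L0 Hs) as Hhit.
  destruct L0 as [Harr L0]. destruct (L0 s Hs) as [Hl [Hend Hfree]].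
  set (l := leg n (E 0%nat) (E 1%nat) (lam 0%nat) s) in *.
  rewrite Hd, Hy, ray_ray in Hhit, Hend.
  assert (Hfree' : forall r, - t < r < l - t -> free n (ray (RtoC a) omega r)).
  { intros r Hr. replace r with (- t + (r + t)) by ring.
    rewrite <- ray_ray, <- Hy, <- Hd. apply Hfree. lra. }
  assert (HKz : KS n z) by (exists e; split; assumption).
  destruct (Rtotal_order tz (- t)) as [Hlt|[Heq|Hgt]].
  - exfalso. rewrite Rmin_right, Rmax_left in Hvis by lra.
    destruct (Rle_lt_dec t 0) as [Ht0|Ht0].
    + assert (t = 0) as -> by lra.
      destruct (exists_link n e He) as [o [q [lam' [Te [Tq L]]]]].
      pose proof (inward_out_dir n (e, o) Te Hin) as Hde.
      destruct (on_side_nonvertex n e z He Hon Hnv) as [x [Hx Hzx]].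
      change (z = side_pt (e, o) x) in Hzx.
      pose proof (link_hit _ _ _ _ x Tq L Hx) as Hhit'.
      destruct L as [_ L]. destruct (L x Hx) as [Hl' [_ Hfr]].
      rewrite Hde, <- Hzx in *. set (l' := leg n (e, o) q lam' x) in *.
      assert (Hl'z : - tz <= l').
      { destruct (Rle_lt_dec (- tz) l') as [H|H]; [exact H|exfalso].
        apply (Hvis (tz + l')); [lra|]. rewrite <- ray_ray, <- Hz. exact Hhit'. }
      pose proof (pow3_pos n) as Hn.
      (* So small a step back from the base point stays in the outer triangle of
         the first side and on the leg from [z]. *)
      set (eta := Rmin (Rmin s (1 - s)) (3 ^ n * - tz) / 2).
      assert (He1 : 0 < eta).
      { unfold eta. assert (0 < 3 ^ n * - tz) by (apply Rmult_lt_0_compat; lra).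
        unfold Rmin. repeat destruct Rle_dec; lra. }
      assert (He2 : eta < s /\ eta < 1 - s /\ eta < 3 ^ n * - tz).
      { unfold eta in *. unfold Rmin in *. repeat destruct Rle_dec; lra. }
      assert (He3 : eta / 3 ^ n < - tz).
      { apply (Rmult_lt_reg_l (3 ^ n)); [lra|].
        replace (3 ^ n * (eta / 3 ^ n)) with eta by (field; lra). lra. }
      assert (He4 : 0 < eta / 3 ^ n) by (apply Rdiv_lt_0_compat; lra).
      apply (Hfr (- tz - eta / 3 ^ n) ltac:(lra) (fst (E 0%nat)) (proj1 T0)).
      rewrite Hz, ray_ray.
      replace (tz + (- tz - eta / 3 ^ n)) with (- 0 + - (eta / 3 ^ n)) by ring.
      rewrite <- ray_ray, <- Hy, <- Hd, ray_out_dir.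
      replace (3 ^ n * - (eta / 3 ^ n)) with (- eta) by (field; lra).
      exists (s + (1 - parity (snd (E 0%nat))) * - eta), (- - eta).
      destruct (snd (E 0%nat)); cbn [parity]; repeat split; lra.
    + apply (Hvis (- t)); [lra|]. rewrite <- Hy.
      exists (fst (E 0%nat)). split; [apply T0|]. apply on_side_pt.
      exists s. split; [lra|reflexivity].
  - rewrite Hz, Heq. symmetry. exact Hy.
  - exfalso.
    assert (Htz : l - t <= tz).
    { destruct (Rle_lt_dec (l - t) tz) as [H|H]; [exact H|exfalso].
      apply (free_not_KS n z); [|exact HKz]. rewrite Hz. apply Hfree'. lra. }
    rewrite Rmin_left, Rmax_right in Hvis by lra.
    destruct (Rle_lt_dec tz (l - t)) as [H|H].
    + assert (tz = - t + l) as -> by lra.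
      rewrite Hend in Hz.
      assert (fst (E 1%nat) = e) as <-.
      { apply (outer_triangles_separated n _ _ z); [apply T1|exact He| |].
        - rewrite Hz. apply side_pt_outer_open. lra.
        - apply on_side_outer, Hon. }
      rewrite <- Hd, Harr in Hin. exact (in_dir_not_inward n _ Hin).
    + apply (Hvis (l - t)); [lra|].
      replace (l - t) with (- t + l) by ring. exact Hhit.
Qed.

(** * Periods and lengths along an itinerary *)

Lemma alternate_mod s N k : Nat.even N = true \/ s = 1/2 -> N <> 0%nat ->
  alternate s (k mod N) = alternate s k.
Proof.
  intros [HN | ->] H0; unfold alternate; [now rewrite even_mod|].
  destruct (Nat.even _), (Nat.even _); lra.
Qed.

(** A state repeats only if the side and the position both do.  Hence the period
    is the cycle length when that is even, or when [s = 1/2], and otherwise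
    [k = 2] turns are needed. *)
Lemma period_itinerary n E lam s M k :
  itinerary n E lam -> cyclic E M -> 0 < s < 1 -> k <> 0%nat ->
  Nat.even (M * k) = true \/ s = 1/2 ->
  (forall i j, (i mod M = j mod M)%nat -> alternate s i = alternate s j ->
               (i mod (M * k) = j mod (M * k))%nat) ->
  period n (itin_state n E s 0) = (M * k)%nat.
Proof.
  intros HE Hc Hs Hk Hev Hinj. pose proof Hc as [HM [HA HB]].
  apply period_orbit with (p := itin_state n E s).
  - nia.
  - intros i. eapply orbit_pt_itinerary; eauto.
  - intros i. unfold itin_state. rewrite alternate_mod by (auto; nia).
    rewrite (cyclic_congr E M i (i mod (M * k))); auto.
    rewrite Nat.Div0.mod_mul_r, Nat.mul_comm, Nat.Div0.mod_add.
    now rewrite Nat.Div0.mod_mod.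
  - intros i j Hi Hj H. apply (f_equal fst) in H.
    change (side_pt (E i) (alternate s i) = side_pt (E j) (alternate s j)) in H.
    pose proof (HE i) as [Ti _]. pose proof (HE j) as [Tj _].
    assert (Hf : fst (E i) = fst (E j)).
    { apply (outer_triangles_separated n _ _ (side_pt (E i) (alternate s i)));
        [apply Ti|apply Tj| |].
      - apply side_pt_outer_open, alternate_range, Hs.
      - rewrite H. apply on_side_outer, on_side_pt.
        exists (alternate s j). split; [|reflexivity].
        pose proof (alternate_range s j Hs). lra. }
    assert (Ha : alternate s i = alternate s j).
    { unfold side_pt in H. rewrite Hf in H. apply pt_inj in H; [apply H|].
      eapply vec_neq0, Tj. }
    specialize (Hinj i j (HB _ _ Hf) Ha).
    now rewrite !Nat.mod_small in Hinj by assumption.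
Qed.

Lemma orbit_length_itinerary n E lam s :
  itinerary n E lam -> 0 < s < 1 ->
  orbit_length n (itin_state n E s 0) =
  total (fun i => leg n (E i) (E (S i)) (lam i) (alternate s i))
        (period n (itin_state n E s 0)).
Proof.
  intros HE Hs. unfold orbit_length. rewrite <- sum_n_m_total.
  apply sum_n_m_ext_loc. intros k Hk.
  destruct k as [|k]; [lia|]. replace (S k - 1)%nat with k by lia.
  rewrite !(orbit_pt_itinerary n E lam) by assumption.
  eapply Cmod_itin_step; eauto.
Qed.

Definition base_sides (i : nat) : tside := base_side (i mod 3).

Lemma base_itinerary : itinerary 0 base_sides (fun _ => 1/2).
Proof.
  intros i. split; [apply base_side_tagged|]. unfold base_sides.
  rewrite <- (Nat.add_1_r i), Nat.Div0.add_mod.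
  replace ((i mod 3 + 1 mod 3) mod 3)%nat with (S (i mod 3) mod 3)%nat.
  - apply base_link. apply Nat.mod_upper_bound. lia.
  - f_equal. change (1 mod 3)%nat with 1%nat. lia.
Qed.

Lemma base_cyclic : cyclic base_sides 3.
Proof.
  split; [lia|]. split.
  - intros i. unfold base_sides. now rewrite Nat.Div0.mod_mod.
  - intros i j H.
    assert (Hz : forall k, pt (fst (base_sides k)) (1/3) 0 =
      match (k mod 3)%nat with
      | 0%nat => Cplus (RtoC (1/3)) (Cmult (RtoC 0) omega)
      | 1%nat => Cplus (RtoC (2/3)) (Cmult (RtoC (1/3)) omega)
      | _ => Cplus (RtoC 0) (Cmult (RtoC (2/3)) omega)
      end).
    { intros k. unfold base_sides. rewrite base_coords.
      destruct (k mod 3) as [|[|]];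
        apply f_equal2; try apply f_equal2; try apply f_equal; lra || reflexivity. }
    assert (K := f_equal (fun e => pt e (1/3) 0) H). cbv beta in K.
    rewrite !Hz in K.
    pose proof (Nat.mod_upper_bound i 3 ltac:(lia)).
    pose proof (Nat.mod_upper_bound j 3 ltac:(lia)).
    destruct (i mod 3)%nat as [|[|[|]]], (j mod 3)%nat as [|[|[|]]]; try lia;
      apply omega_coords_inj in K; exfalso; lra.
Qed.

Lemma mod_6_of_mod_3 i j : (i mod 3 = j mod 3)%nat -> Nat.even i = Nat.even j ->
  (i mod 6 = j mod 6)%nat.
Proof.
  assert (K : forall k, (k mod 3 = (k mod 6) mod 3)%nat).
  { intros k. change 6%nat with (3 * 2)%nat.
    rewrite Nat.Div0.mod_mul_r, (Nat.mul_comm 3), Nat.Div0.mod_add.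
    now rewrite Nat.Div0.mod_mod. }
  rewrite (K i), (K j).
  rewrite <- (even_mod i 6), <- (even_mod j 6) by (reflexivity || discriminate).
  pose proof (Nat.mod_upper_bound i 6 ltac:(lia)).
  pose proof (Nat.mod_upper_bound j 6 ltac:(lia)).
  destruct (i mod 6)%nat as [|[|[|[|[|[|]]]]]]; try lia;
    destruct (j mod 6)%nat as [|[|[|[|[|[|]]]]]]; try lia;
    simpl; congruence.
Qed.

Lemma fagnano_state : fagnano = itin_state 0 base_sides (1/2) 0.
Proof.
  unfold fagnano, itin_state, base_sides, side_pt, alternate, out_dir, base_side, vec.
  cbn [Nat.modulo Nat.divmod Nat.sub Nat.even fst snd parity pow]. f_equal.
  - unfold pt. cbn [fst snd]. ceq.
  - ceq.
Qed.

(** Three legs of length 1/2: the position 1/2 is its own mirror image, so one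
    turn of the odd cycle closes the orbit. *)
Lemma fagnano_length : orbit_length 0 fagnano = 3 / 2.
Proof.
  rewrite fagnano_state.
  rewrite (orbit_length_itinerary 0 base_sides _ (1/2) base_itinerary) by lra.
  rewrite (period_itinerary 0 base_sides _ (1/2) 3 1 base_itinerary base_cyclic);
    [|lra|lia|right; reflexivity|].
  - simpl total. unfold leg, alternate, base_sides, base_side. simpl. lra.
  - intros i j H _. exact H.
Qed.

(** Away from the midpoint two turns of the cycle of three sides are needed; this
    is the source of the factor 2 in front of the Fagnano length. *)
Lemma base_length a : 0 < a < 1 -> a <> 1/2 ->
  orbit_length 0 (itin_state 0 base_sides a 0) = 3.
Proof.
  intros Ha Ha2.
  rewrite (orbit_length_itinerary 0 base_sides _ a base_itinerary) by lra.
  rewrite (period_itinerary 0 base_sides _ a 3 2 base_itinerary base_cyclic);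
    [|lra|lia|left; reflexivity|].
  - rewrite (total_leg 0 base_sides (fun _ => 1/2) a) by reflexivity.
    simpl. lra.
  - intros i j H H'. apply mod_6_of_mod_3; [exact H|].
    unfold alternate in H'. destruct (Nat.even i), (Nat.even j); auto; lra.
Qed.

(** * Ternary digits *)

(** The number whose expansion is the sequence of the digits after the [n]-th; it
    is the relative position of the starting point on its side of [KS n]. *)
Fixpoint digit_tail (d : nat -> nat) (a : R) (n : nat) : R :=
  match n with O => a | S m => 3 * digit_tail d a m - INR (d (S m)) end.

Definition shift (d : nat -> nat) (i : nat) : nat := d (S i).

Lemma ternary_shift d a : ternary_expansion d a ->
  ternary_expansion (shift d) (3 * a - INR (d 1%nat)).
Proof.
  intros [H1 H2]. split; [intros i Hi; apply H1; lia|].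
  assert (K : is_series (fun k => INR (d (S (S k))) / 3 ^ S (S k))
                        (a - INR (d 1%nat) / 3)).
  { apply (is_series_incr_1 (fun k => INR (d (S k)) / 3 ^ S k)).
    match goal with |- is_series _ ?l => replace l with a; [exact H2|] end.
    unfold plus. simpl. field. }
  apply (is_series_scal_l 3) in K.
  replace (3 * a - INR (d 1%nat)) with (3 * (a - INR (d 1%nat) / 3)) by field.
  eapply is_series_ext; [|exact K].
  intros k. unfold shift. cbn [pow].
  pose proof (pow3_pos k). change (scal 3 ?x) with (3 * x).
  match goal with |- ?u = ?v => change (@eq R u v) end. field. lra.
Qed.

Lemma ternary_range d a : ternary_expansion d a -> 0 <= a <= 1.
Proof.
  intros [H1 H2].
  assert (B : forall n, 0 <= sum_n (fun k => INR (d (S k)) / 3 ^ S k) n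
                          <= 1 - / 3 ^ S n).
  { assert (T : forall k, 0 <= INR (d (S k)) / 3 ^ S k <= 2 * / 3 ^ S k).
    { intros k. pose proof (Rinv_0_lt_compat _ (pow3_pos (S k))) as Hp.
      pose proof (pos_INR (d (S k))).
      assert (INR (d (S k)) <= 2).
      { replace 2 with (INR 2) by reflexivity. apply le_INR, H1. lia. }
      unfold Rdiv. split; [nra|]. apply Rmult_le_compat_r; lra. }
    induction n as [|n IH].
    - rewrite sum_O. specialize (T 0%nat). cbn [pow] in *. lra.
    - rewrite sum_Sn. change (plus ?x ?y) with (x + y). specialize (T (S n)).
      assert (E : / 3 ^ S n = 3 * / 3 ^ S (S n)).
      { cbn [pow]. pose proof (pow3_pos n). field. lra. }
      lra. }
  assert (L : is_lim_seq (sum_n (fun k => INR (d (S k)) / 3 ^ S k)) a) by exact H2.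
  split.
  - apply (is_lim_seq_le (fun _ => 0) _ 0 a (fun n => proj1 (B n))
             (is_lim_seq_const 0) L).
  - refine (is_lim_seq_le _ (fun _ => 1) a 1 _ L (is_lim_seq_const 1)).
    intros n. pose proof (B n).
    pose proof (Rinv_0_lt_compat _ (pow3_pos (S n))). lra.
Qed.

Lemma finite_ternary_0 : finite_ternary 0.
Proof.
  exists (fun _ => 0%nat), 0%nat. split; [|auto]. split; [intros; lia|].
  assert (K : is_lim_seq (sum_n (fun k : nat => INR 0 / 3 ^ S k)) 0); [|exact K].
  apply (is_lim_seq_ext (fun _ => 0)); [|apply is_lim_seq_const].
  intros n. symmetry. induction n as [|n IH].
  - rewrite sum_O. simpl. field.
  - rewrite sum_Sn, IH. change (plus ?x ?y) with (x + y). simpl INR.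
    pose proof (pow3_pos (S (S n))). field. lra.
Qed.

Lemma finite_ternary_cons c a : (c <= 2)%nat ->
  finite_ternary (3 * a - INR c) -> finite_ternary a.
Proof.
  intros Hc [d [N [[H1 H2] H3]]].
  exists (fun i => match i with 0%nat | 1%nat => c | S j => d j end), (S (S N)).
  split; [split|].
  - intros [|[|i]] Hi; try exact Hc. apply H1. lia.
  - apply is_series_decr_1. apply (is_series_scal_l (/ 3)) in H2.
    match goal with |- is_series _ ?l =>
      replace l with (/ 3 * (3 * a - INR c)) by (unfold plus, opp; simpl; field)
    end.
    eapply is_series_ext; [|exact H2].
    intros k. change (scal (/ 3) ?x) with (/ 3 * x). cbn [pow].
    pose proof (pow3_pos k).
    match goal with |- ?u = ?v => change (@eq R u v) end. field. lra.
  - intros [|[|i]] Hi; try lia. apply H3. lia.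
Qed.

Lemma digit_tail_ternary d a n : ternary_expansion d a ->
  ternary_expansion (fun i => d (n + i)%nat) (digit_tail d a n).
Proof.
  intros H. induction n as [|n IH]; [exact H|].
  apply ternary_shift in IH. cbn [digit_tail]. rewrite Nat.add_1_r in IH.
  replace (fun i => d (S n + i)%nat) with (shift (fun i => d (n + i)%nat));
    [exact IH|].
  apply functional_extensionality. intros i.
  unfold shift. f_equal. lia.
Qed.

(** A tail equal to 0 makes the expansion finite.  So does a tail equal to 1,
    after raising the last digit that is not 2, unless all digits are 2 and
    [a = 1]. *)
Lemma digit_tail_range d a n :
  ternary_expansion d a -> ~ finite_ternary a -> a <> 1 -> 0 < digit_tail d a n < 1.
Proof.
  intros Hd Hf H1.
  assert (K : ~ finite_ternary (digit_tail d a n) /\ digit_tail d a n <> 1).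
  { induction n as [|n [IH1 IH2]]; [auto|].
    assert (Hc : (d (S n) <= 2)%nat) by (apply Hd; lia).
    cbn [digit_tail]. split.
    - intros H. apply IH1. exact (finite_ternary_cons _ _ Hc H).
    - intros H. destruct (Nat.eq_dec (d (S n)) 2) as [E|E].
      + apply IH2. rewrite E in H. simpl in H. lra.
      + apply IH1. apply (finite_ternary_cons (S (d (S n)))); [lia|].
        rewrite S_INR. replace (3 * digit_tail d a n - (INR (d (S n)) + 1)) with 0 by lra.
        apply finite_ternary_0. }
  pose proof (ternary_range _ _ (digit_tail_ternary d a n Hd)) as Hr.
  destruct K as [K1 K2]. split; [|lra].
  destruct (Req_dec (digit_tail d a n) 0) as [E|E]; [|lra].
  exfalso. apply K1. rewrite E. apply finite_ternary_0.
Qed.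

(** * The itinerary of the orbits *)

Fixpoint itin (d : nat -> nat) (n : nat) : (nat -> tside) * (nat -> R) :=
  match n with
  | O => (base_sides, fun _ => 1/2)
  | S m =>
      let E := fst (itin d m) in
      let lam := snd (itin d m) in
      match d (S m) with
      | 0%nat => (outer_sides false E, outer_lengths m false E lam)
      | 1%nat => (middle_sides E, middle_lengths m lam)
      | _ => (outer_sides true E, outer_lengths m true E lam)
      end
  end.

(** The first refinement doubles the cycle for every digit, because the cycle of
    the initial triangle is odd. *)
Fixpoint cycle_length (d : nat -> nat) (n : nat) : nat :=
  match n with
  | O => 3
  | S m =>
      if orb (m =? 0)%nat (d (S m) =? 1)%nat then (2 * cycle_length d m)%nat
      else cycle_length d m
  end.

Lemma itin_itinerary d n : itinerary n (fst (itin d n)) (snd (itin d n)).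
Proof.
  induction n as [|n IH]; [exact base_itinerary|]. cbn [itin].
  destruct (d (S n)) as [|[|]]; cbn [fst snd];
    auto using outer_itinerary, middle_itinerary.
Qed.

Lemma cycle_length_even d n : Nat.even (cycle_length d (S n)) = true.
Proof.
  induction n as [|n IH]; [reflexivity|].
  change (cycle_length d (S (S n))) with
    (if orb (S n =? 0)%nat (d (S (S n)) =? 1)%nat
     then (2 * cycle_length d (S n))%nat else cycle_length d (S n)).
  destruct (orb _ _); [apply Nat.even_even|exact IH].
Qed.

Lemma itin_cyclic d n : cyclic (fst (itin d n)) (cycle_length d n).
Proof.
  induction n as [|n IH]; [exact base_cyclic|].
  pose proof (itin_itinerary d n) as HE.
  assert (Ho : forall c, d (S n) <> 1%nat ->
    cyclic (outer_sides c (fst (itin d n))) (cycle_length d (S n))).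
  { intros c Hd. cbn [cycle_length].
    apply Nat.eqb_neq in Hd. rewrite Hd. destruct n as [|n]; cbn [Nat.eqb orb].
    - rewrite Nat.mul_comm. eapply outer_cyclic; eauto.
      exact mod_6_of_mod_3.
    - rewrite <- Nat.mul_1_r. eapply outer_cyclic; eauto.
      + rewrite Nat.mul_1_r. apply cycle_length_even.
      + intros i j H _. now rewrite Nat.mul_1_r. }
  cbn [itin]. destruct (d (S n)) as [|[|k]] eqn:Ed; cbn [fst].
  - apply Ho. lia.
  - cbn [cycle_length]. rewrite Ed. rewrite Bool.orb_true_r.
    eapply middle_cyclic; eauto.
  - apply Ho. lia.
Qed.

Lemma itin_started d a n :
  ternary_expansion d a -> ~ finite_ternary a -> a <> 1 ->
  exists t, started n (fst (itin d n)) (snd (itin d n)) a (digit_tail d a n) t.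
Proof.
  intros Hd Hf H1. induction n as [|n [t IH]].
  - exists 0. pose proof (digit_tail_range d a 0 Hd Hf H1) as Ha. cbn [digit_tail] in *.
    unfold started, leg, side_pt, out_dir, itin, base_sides, base_side, vec.
    simpl snd. simpl fst. cbn [parity pow]. split; [|split].
    + unfold pt, ray, omega. cbn [fst snd]. ceq.
    + unfold omega. ceq.
    + lra.
  - pose proof (digit_tail_range d a (S n) Hd Hf H1) as Hs.
    assert (Hc : (d (S n) <= 2)%nat) by (apply Hd; lia).
    cbn [itin]. cbn [digit_tail] in Hs |- *.
    set (s := 3 * digit_tail d a n - INR (d (S n))) in *.
    destruct (d (S n)) as [|[|[|]]] eqn:E; try lia; cbn [fst snd].
    + exists t. apply (outer_started n false).
      replace (s / 3) with (digit_tail d a n) by (unfold s; simpl; field). exact IH.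
    + eexists. apply middle_started; [exact Hs|].
      replace ((1 + s) / 3) with (digit_tail d a n) by (unfold s; simpl; field). exact IH.
    + exists t. apply (outer_started n true).
      replace (2 / 3 + s / 3) with (digit_tail d a n) by (unfold s; simpl; field). exact IH.
Qed.

(** The doubling in the first refinement already accounts for the whole term
    [2 L], whatever the first digit is; so the sum in the theorem starts at 2. *)
Lemma itin_total_1 d : total (snd (itin d 1)) (cycle_length d 1) = 3.
Proof.
  cbn [itin cycle_length Nat.eqb orb]. simpl Nat.mul.
  destruct (d 1%nat) as [|[|]]; cbn [snd fst].
  - unfold outer_lengths. rewrite (total_leg 0) by reflexivity. simpl. lra.
  - change 6%nat with (2 * 3)%nat. rewrite total_middle. simpl. lra.
  - unfold outer_lengths. rewrite (total_leg 0) by reflexivity. simpl. lra.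
Qed.

Lemma itin_total_S d n : (d (S (S n)) <= 2)%nat ->
  total (snd (itin d (S (S n)))) (cycle_length d (S (S n))) =
  total (snd (itin d (S n))) (cycle_length d (S n)) +
  chi (d (S (S n))) * INR (cycle_length d (S n)) * (3 / 2 / 3 ^ S (S n)).
Proof.
  intros Hd.
  pose proof (itin_cyclic d (S n)) as Hc. pose proof (cycle_length_even d n) as Hev.
  assert (Ho : forall c, total (outer_lengths (S n) c (fst (itin d (S n)))
       (snd (itin d (S n)))) (cycle_length d (S n)) =
     total (snd (itin d (S n))) (cycle_length d (S n))).
  { intros c. unfold outer_lengths. apply total_leg; [exact Hev|].
    rewrite (cyclic_congr _ _ (cycle_length d (S n)) 0 Hc); [reflexivity|].
    now rewrite Nat.Div0.mod_same, Nat.Div0.mod_0_l. }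
  set (m := S n) in *. cbn [itin cycle_length].
  replace (m =? 0)%nat with false by reflexivity. unfold chi.
  destruct (d (S m)) as [|[|[|]]]; try lia; cbn [Nat.eqb orb fst snd].
  - rewrite Ho. ring.
  - rewrite total_middle. cbn [pow]. pose proof (pow3_pos m). field. lra.
  - rewrite Ho. ring.
Qed.

Lemma itin_period d n s : 0 < s < 1 ->
  period (S n) (itin_state (S n) (fst (itin d (S n))) s 0) =
  cycle_length d (S n).
Proof.
  intros Hs. rewrite <- (Nat.mul_1_r (cycle_length d (S n))).
  eapply period_itinerary; eauto using itin_itinerary, itin_cyclic.
  - left. rewrite Nat.mul_1_r. apply cycle_length_even.
  - intros i j H _. now rewrite Nat.mul_1_r.
Qed.

Lemma itin_orbit_length d n s : 0 < s < 1 ->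
  orbit_length (S n) (itin_state (S n) (fst (itin d (S n))) s 0) =
  total (snd (itin d (S n))) (cycle_length d (S n)).
Proof.
  intros Hs. rewrite (orbit_length_itinerary _ _ _ s (itin_itinerary d (S n)) Hs).
  rewrite itin_period by exact Hs.
  apply total_leg; [apply cycle_length_even|].
  rewrite (cyclic_congr _ _ (cycle_length d (S n)) 0 (itin_cyclic d (S n)));
    [reflexivity|].
  now rewrite Nat.Div0.mod_same, Nat.Div0.mod_0_l.
Qed.

Lemma compatible_start x a d n :
  x 0%nat = RtoC a -> ~ finite_ternary a -> ternary_expansion d a -> a <> 1 ->
  compatible_periodic (fun i => (x i, unit_dir (PI / 3))) ->
  (x n, unit_dir (PI / 3)) = itin_state n (fst (itin d n)) (digit_tail d a n) 0.
Proof.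
  intros Hx Hf Hd H1 [Hc Hp].
  destruct (itin_started d a n Hd Hf H1) as [t Hs].
  pose proof (digit_tail_range d a n Hd Hf H1) as Hr.
  destruct (Hc n) as [Hph [_ [tz [Hz Hvis]]]]. cbn [fst snd] in *.
  rewrite Hx in Hz, Hvis.
  assert (Hnv : ~ KS_vertex n (x n)).
  { intros Hv. destruct (Hp n) as [_ [_ Hns]]. apply Hns.
    exists (x n, unit_dir (PI / 3)). split; [exists 0%nat; reflexivity|exact Hv]. }
  unfold itin_state. f_equal.
  - exact (start_unique _ _ _ _ _ _ _ _ (itin_itinerary d n) Hr Hs Hph Hnv Hz Hvis).
  - symmetry. apply Hs.
Qed.

Theorem theorem4p29 (x : nat -> C) (a : R) (d : nat -> nat)
  (hx0 : x 0%nat = RtoC a) (haI : 0 <= a <= 1)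
  (hfin : ~ finite_ternary a)
  (hd : ternary_expansion d a)
  (hcomp : compatible_periodic (fun i => (x i, unit_dir (PI / 3))))
  (n : nat) (hn : n = 0%nat -> a <> 1 / 2) :
  let L := orbit_length 0 fagnano in
  orbit_length n (x n, unit_dir (PI / 3)) =
    2 * L +
    sum_n_m (fun i => chi (d i)
                      * INR (period (i - 1) (x (i - 1)%nat, unit_dir (PI / 3)))
                      * (L / 3 ^ i)) 2 n.
Proof.
  intros L. unfold L. rewrite fagnano_length. clear L.
  assert (H1 : a <> 1).
  { intros ->. destruct hcomp as [_ Hp]. destruct (Hp 0%nat) as [_ [_ Hns]].
    apply Hns. exists (x 0%nat, unit_dir (PI / 3)).
    split; [exists 0%nat; reflexivity|]. cbn [fst]. rewrite hx0.
    exists (RtoC 0, RtoC 1). split; [left; reflexivity|right; reflexivity]. }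
  assert (Hst : forall m, (x m, unit_dir (PI / 3)) =
                itin_state m (fst (itin d m)) (digit_tail d a m) 0).
  { intros m. apply compatible_start; assumption. }
  assert (Hr : forall m, 0 < digit_tail d a m < 1).
  { intros m. apply digit_tail_range; assumption. }
  destruct n as [|n].
  - rewrite sum_n_m_zero by lia. change zero with 0. rewrite Hst.
    change (orbit_length 0 (itin_state 0 base_sides a 0) = 2 * (3 / 2) + 0).
    rewrite base_length; [lra|exact (Hr 0%nat)|exact (hn eq_refl)].
  - rewrite Hst, itin_orbit_length by apply Hr.
    induction n as [|n IH].
    + rewrite itin_total_1, sum_n_m_zero by lia. change zero with 0. lra.
    + rewrite itin_total_S by (apply hd; lia).
      rewrite sum_n_Sm by lia. rewrite IH by discriminate.
      change (plus ?u ?v) with (u + v).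
      replace (S (S n) - 1)%nat with (S n) by lia.
      rewrite Hst, itin_period by apply Hr. ring.
Qed.
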